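(* Let $2\le r<m\le n$ and $k\ge r$, and write $k=\lambda r+\mu$ with $\lambda\ge1$ and $0\le\mu<r$. For $0\le s\le\lambda-1$ let $c_s$ be the codimension of $\mathcal Z^{m-1,n-1}_{r-1,k-rs}$ in $\mathbf A^{(m-1)(n-1)(k-rs)}$; let $c_\lambda=0$ if $\mu=0$, and let $c_\lambda$ be the codimension of $\mathcal Z^{m,n}_{r,\mu}$ in $\mathbf A^{mn\mu}$ if $\mu>0$. Then the codimension of $\mathcal Z^{m,n}_{r,k}$ in $\mathbf A^{mnk}$ equals $$\min_{0\le s\le\lambda}\big(c_s+s\,mn\big).$$
   Context: Let $F$ be an algebraically closed field. For integers $1\le r\le m\le n$ and $k\ge 1$, let $S=F[x^{(l)}_{i,j}:1\le i\le m,\ 1\le j\le n,\ 0\le l\le k-1]$, the coordinate ring of $\mathbf A^{mnk}_F$, and let $X(t)$ be the $m\times n$ matrix over $S[t]/(t^k)$ with $(i,j)$ entry $x_{i,j}(t)=\sum_{l=0}^{k-1}x^{(l)}_{i,j}t^l$. $\mathcal I^{m,n}_{r,k}\subseteq S$ is the ideal generated by the coefficients of $t^l$, $0\le l\le k-1$, of all $r\times r$ minors of $X(t)$, and $\mathcal Z^{m,n}_{r,k}\subseteq\mathbf A^{mnk}_F$ is its zero set (same definition for other index values). The codimension of a (possibly reducible) variety is the minimum of the codimensions of its irreducible components. *)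

(* Defs.v *)
From HB Require Import structures.
From mathcomp Require Import all_boot all_order all_algebra.
From mathcomp Require Import mpoly.
Set Implicit Arguments. Unset Strict Implicit. Unset Printing Implicit Defensive.
Import GRing.Theory.
Local Open Scope ring_scope.

Section Zariski.
Variables (F : closedFieldType) (I : finType).

Definition aset := (I -> F) -> Prop.

Definition peval (p : {mpoly F[#|I|]}) (x : I -> F) : F :=
  p.@[fun i : 'I_#|I| => x (enum_val i)].

Definition zclosed (S : aset) : Prop :=
  exists P : {mpoly F[#|I|]} -> Prop,
    forall x, S x <-> (forall p, P p -> peval p x = 0).

Definition asubset (A B : aset) : Prop := forall x, A x -> B x.
Definition aproper (A B : aset) : Prop := asubset A B /\ ~ asubset B A.

Definition irreducible_closed (W : aset) : Prop :=
  zclosed W /\ (exists x, W x) /\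
  (forall A B : aset, zclosed A -> zclosed B ->
     asubset W (fun x => A x \/ B x) -> asubset W A \/ asubset W B).

Definition chain_below (W : aset) (d : nat) : Prop :=
  exists Ws : nat -> aset,
    (forall i, (i <= d)%N -> irreducible_closed (Ws i)) /\
    (forall i, (i < d)%N -> aproper (Ws i) (Ws i.+1)) /\
    Ws d = W.

Definition is_dim (W : aset) (d : nat) : Prop :=
  chain_below W d /\ (forall d', chain_below W d' -> (d' <= d)%N).

Definition irr_component (Z W : aset) : Prop :=
  irreducible_closed W /\ asubset W Z /\
  (forall W', irreducible_closed W' -> asubset W W' -> asubset W' Z ->
     asubset W' W).

Definition is_codim (Z : aset) (c : nat) : Prop :=
  (exists W d, irr_component Z W /\ is_dim W d /\ c = (#|I| - d)%N) /\
  (forall W d, irr_component Z W -> is_dim W d -> (c <= #|I| - d)%N).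

End Zariski.

(* The arc-space determinantal variety Z^{m,n}_{r,k} in A^{mnk}:
   coordinates x^{(l)}_{i,j} indexed by (i,j,l). *)
Section Arc.
Variable F : closedFieldType.

Definition Xt (m n k : nat) (x : 'I_m * 'I_n * 'I_k -> F) (i : 'I_m) (j : 'I_n)
  : {poly F} := \sum_(l < k) x (i, j, l) *: 'X^l.

(* all coefficients of t^l, l < k, of all r x r minors of X(t) vanish
   (truncating mod t^k does not change these coefficients) *)
Definition Zvar (m n r k : nat) : aset F ('I_m * 'I_n * 'I_k)%type :=
  fun x => forall (f : 'I_r -> 'I_m) (g : 'I_r -> 'I_n),
    injective f -> injective g ->
    forall l : nat, (l < k)%N ->
      (\det (\matrix_(a < r, b < r) Xt x (f a) (g b)))`_l = 0.

End Arc.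

(* Main.v *)
(** For an arbitrary set Y of points let dim_ge Y d say that some d polynomial functions are algebraically
    independent on Y. The largest such d is monotone along polynomial maps, is the maximum over the pieces of a
    finite union, and three facts tie it to chains of irreducible closed sets and to coordinates:
    - d grows strictly along proper inclusions of irreducible closed sets (divide a relation by the new function);
    - conversely a generic level set of one of d+1 independent functions has d independent ones, because the image
      of a dominant map contains a principal open set; this yields chains of length d;
    - the independent functions can be taken among the coordinates (count the monomials modulo the relations),
      which gives dim (Z x A^q) <= dim Z + q.
    So the codimension of a nonempty closed set Z is the number of coordinates minus the largest d with dim_ge Z d.

    The arcs X(t) in the variety for (m, n, r, k) with X(0) = 0 are X = t X' with X' mod t^(k-r) in the variety for
    (m, n, r, k-r) and mn(r-1) free coefficients. Those with a given entry of X(0) nonzero are, after clearing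
    the row and column of that entry, a product of the variety for (m-1, n-1, r-1, k) and an open subset of an
    affine space of dimension k(m+n-1). Hence codim(k) = min(c_0, mn + codim(k-r)), and one iterates. *)

Require Import Defs.
From HB Require Import structures.
From mathcomp Require Import all_boot all_order all_algebra.
From mathcomp Require Import perm closed_field mpoly zify.
From Stdlib Require Import Classical ClassicalEpsilon FunctionalExtensionality.
Set Implicit Arguments. Unset Strict Implicit. Unset Printing Implicit Defensive.
Import GRing.Theory.
Local Open Scope ring_scope.

(** * Multivariate polynomials *)

Lemma mpoly_ring_ind (R : comNzRingType) n (P : {mpoly R[n]} -> Prop) :
    (forall c, P c%:MP) -> (forall i, P 'X_i) ->
    (forall p q, P p -> P q -> P (p + q)) ->
    (forall p q, P p -> P q -> P (p * q)) ->
  forall p, P p.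
Proof.
move=> PC PX PD PM p.
have P0 : P 0 by rewrite -mpolyC0.
have P1 : P 1 by rewrite -mpolyC1.
rewrite [p]mpolyE; apply: (big_ind P P0 PD) => m _; rewrite -mul_mpolyC.
apply/PM; first exact: PC.
rewrite mpolyXE_id; apply: (big_ind P P1 PM) => i _.
by elim: (m i) => [|e IHe]; rewrite ?expr0 // exprS; apply: PM.
Qed.

Lemma muni_X_widen (R : comNzRingType) n (i : 'I_n) :
  muni ('X_(widen_ord (leqnSn n) i) : {mpoly R[n.+1]}) = ('X_i)%:P.
Proof.
rewrite muniE msuppX big_seq1 mcoeffX eqxx scale1r mnm1E.
have -> : (widen_ord (leqnSn n) i == ord_max) = false.
  by apply/eqP => /(congr1 val) /= e; have := ltn_ord i; rewrite e ltnn.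
rewrite expr0 alg_polyC; congr (_%:P); congr 'X_[_]; apply/mnmP => j.
by rewrite mnmE !mnm1E.
Qed.

Lemma muni_X_max (R : comNzRingType) n :
  muni ('X_ord_max : {mpoly R[n.+1]}) = 'X.
Proof.
rewrite muniE msuppX big_seq1 mcoeffX eqxx scale1r mnm1E eqxx expr1.
rewrite (_ : [multinom _ | _ < _] = 0%MM) ?mpolyX0 ?scale1r //.
apply/mnmP => j; rewrite mnmE mnm1E mnm0E.
apply/eqP; rewrite eqb0; apply/eqP => /(congr1 val) /= e.
by have := ltn_ord j; rewrite -e ltnn.
Qed.

Lemma widen_or_max n (i : 'I_n.+1) :
  (exists j, i = widen_ord (leqnSn n) j) \/ i = ord_max.
Proof.
have [lt|ge] := ltnP i n; [left | right].
  by exists (Ordinal lt); apply/val_inj.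
by apply/val_inj/eqP; rewrite eqn_leq ge -ltnS ltn_ord.
Qed.

Lemma meval_muni (R : comNzRingType) n (v : 'I_n.+1 -> R) (p : {mpoly R[n.+1]}) :
  p.@[v] =
    (map_poly (meval (v \o widen_ord (leqnSn n))) (muni p)).[v ord_max].
Proof.
elim/mpoly_ring_ind: p => [c|i|p q IHp IHq|p q IHp IHq].
- by rewrite muniC mevalC map_polyC /= hornerC mevalC.
- rewrite mevalXU; have [[j ->]|->] := widen_or_max i.
    by rewrite muni_X_widen map_polyC hornerC /= mevalXU.
  by rewrite muni_X_max map_polyX hornerX.
- by rewrite mevalD muniD rmorphD hornerD /= IHp IHq.
- by rewrite mevalM muniM rmorphM hornerM /= IHp IHq.
Qed.

(** Substituting the last variable back into the widened coefficients is a left inverse [h] of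
    [muni], as one checks on generators. *)
Lemma muni_eq0 (R : comNzRingType) n (p : {mpoly R[n.+1]}) :
  muni p = 0 -> p = 0.
Proof.
pose h (P : {poly {mpoly R[n]}}) : {mpoly R[n.+1]} :=
  (map_poly (@mwiden n R) P).['X_ord_max].
have hD a b : h (a + b) = h a + h b by rewrite /h rmorphD hornerD.
have hM a b : h (a * b) = h a * h b by rewrite /h rmorphM hornerM.
have hK : cancel (@muni n R) h.
  elim/mpoly_ring_ind => [c|i|u w IHu IHw|u w IHu IHw].
  - by rewrite /h muniC map_polyC hornerC /= mwidenC.
  - rewrite /h; have [[j ->]|->] := widen_or_max i.
      by rewrite muni_X_widen map_polyC hornerC /= mwidenX mnmwiden1.
    by rewrite muni_X_max map_polyX hornerX.
  - by rewrite muniD; apply: etrans (hD _ _) (f_equal2 +%R IHu IHw).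
  - by rewrite muniM; apply: etrans (hM _ _) (f_equal2 *%R IHu IHw).
by move=> p0; rewrite -[p]hK p0 /h rmorph0 horner0.
Qed.

(** The new entry sits at [ord_max], the variable that [muni] singles out, so a relation involving
    one more function becomes a univariate polynomial in that function. *)
Definition snoc T n (v : 'I_n -> T) (a : T) (j : 'I_n.+1) : T :=
  if unlift ord_max j is Some j' then v j' else a.

Lemma snoc_widen T n (v : 'I_n -> T) a j : snoc v a (widen_ord (leqnSn n) j) = v j.
Proof.
rewrite /snoc; have -> : widen_ord (leqnSn n) j = lift ord_max j.
  by apply/val_inj; rewrite /= /bump leqNgt ltn_ord.
by rewrite liftK.
Qed.

Lemma snoc_max T n (v : 'I_n -> T) a : snoc v a ord_max = a.
Proof. by rewrite /snoc unlift_none. Qed.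

Section InfiniteField.
Variable F : closedFieldType.

Lemma poly_nonroot (p : {poly F}) : p != 0 -> exists a, p.[a] != 0.
Proof. by move=> p0; have [a] := PreClosedField.closed_nonrootP (@solve_monicpoly F) p p0; exists a. Qed.

(** Induction on the number of variables: with the others fixed, the polynomial in the last variable
    has no nonroot, hence is zero, so each coefficient vanishes at every point. *)
Lemma mpoly_eq0_eval n (p : {mpoly F[n]}) : (forall v, p.@[v] = 0) -> p = 0.
Proof.
elim: n p => [|n IHn] p p0.
  by have := p0 (fun _ => 0); rewrite [p]nvar0_mpolyC mevalC => ->; rewrite mpolyC0.
apply: muni_eq0; apply/polyP => i; rewrite coef0; apply: IHn => v.
set q := map_poly (meval v) (muni p).
suff q0 : q = 0 by rewrite -[LHS](coef_map (meval v)) -/q q0 coef0.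
apply/eqP; apply/negP => /negP /poly_nonroot [a]; case/negP.
have -> : q = map_poly (meval (snoc v a \o widen_ord (leqnSn n))) (muni p).
  by apply: eq_map_poly => r; apply: meval_eq => j; rewrite /= snoc_widen.
by rewrite -{2}(snoc_max v a) -meval_muni p0.
Qed.

End InfiniteField.

(** * Noetherianity *)

Lemma dickson n (L : 'X_{1..n} -> Prop) :
  exists l : seq 'X_{1..n}, (forall m, m \in l -> L m) /\
    forall m, L m -> exists2 m', m' \in l & (m' <= m)%MM.
Proof.
(* The induction compares only the first [j] exponents. *)
suff /(_ n L) [l [lL Ll]] : forall j (L : 'X_{1..n} -> Prop),
    exists l : seq 'X_{1..n}, (forall m, m \in l -> L m) /\
    forall m, L m -> exists2 m', m' \in l & forall i : 'I_n, (i < j)%N -> (m' i <= m i)%N.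
  exists l; split=> // m /Ll [m' m'l le]; exists m' => //.
  by apply/mnm_lepP => i; apply/le/ltn_ord.
elim=> [|j IHj] {}L.
  have [[m Lm]|nL] := classic (exists m, L m).
    by exists [:: m]; split=> [m'|m' _]; [rewrite inE => /eqP ->|exists m; rewrite ?inE].
  by exists [::]; split=> // m Lm; case: nL; exists m.
have [jn|jn] := ltnP j n; last first.
  have [l [lL Ll]] := IHj L; exists l; split=> // m /Ll [m' m'l le]; exists m' => // i _.
  by apply: le; apply: leq_trans jn.
pose j' := Ordinal jn.
have [l0 [l0L Ll0]] := IHj L.
(* Monomials whose exponent at [j'] reaches the maximum over [l0] are covered by [l0]; the others
   are treated one exponent value at a time. *)
have [l1 [l1L Ll1]] : exists l : seq 'X_{1..n}, (forall m, m \in l -> L m) /\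
    forall m, L m -> (m j' < \max_(m' <- l0) m' j')%N ->
      exists2 m', m' \in l & forall i : 'I_n, (i < j.+1)%N -> (m' i <= m i)%N.
  elim: (\max_(m' <- l0) m' j') => [|D [l [lL Ll]]]; first by exists [::].
  have [l' [l'L Ll']] := IHj (fun m => L m /\ m j' = D).
  exists (l ++ l'); split=> [m|m Lm].
    by rewrite mem_cat => /orP[/lL //|/l'L []].
  rewrite ltnS leq_eqVlt => /orP[/eqP mD|/(Ll m Lm) [m' m'l le]]; last first.
    by exists m'; rewrite ?mem_cat ?m'l.
  have [m' m'l le] := Ll' m (conj Lm mD); exists m'; first by rewrite mem_cat m'l orbT.
  move=> i; rewrite ltnS leq_eqVlt => /orP[/eqP ij|]; last exact: le.
  have -> : i = j' by apply/val_inj.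
  by rewrite mD (l'L _ m'l).2.
exists (l0 ++ l1); split=> [m|m Lm].
  by rewrite mem_cat => /orP[/l0L|/l1L].
have [lt|ge] := ltnP (m j') (\max_(m' <- l0) m' j').
  by have [m' m'l le] := Ll1 m Lm lt; exists m'; rewrite ?mem_cat ?m'l ?orbT.
have [m' m'l le] := Ll0 m Lm; exists m'; first by rewrite mem_cat m'l.
move=> i; rewrite ltnS leq_eqVlt => /orP[/eqP ij|]; last exact: le.
have -> : i = j' by apply/val_inj.
by apply: leq_trans ge; apply: (@leq_bigmax_seq _ l0 predT (fun m0 : 'X_{1..n} => m0 j')).
Qed.

Section Noether.
Variable F : fieldType.

Lemma mlead_cancel n (p r : {mpoly F[n]}) : p != 0 -> r != 0 -> mlead r = mlead p ->
  let q := p - (mleadc p / mleadc r) *: r in q = 0 \/ (mlead q < mlead p)%O.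
Proof.
move=> p0 r0 lead q.
have [->|q0] := eqVneq q 0; [by left | right].
have lead' : mlead ((mleadc p / mleadc r) *: r) = mlead p.
  by rewrite mleadZ // mulf_neq0 ?invr_eq0 ?mleadc_eq0.
have := mleadB_le p ((mleadc p / mleadc r) *: r).
rewrite lead' Order.JoinTheory.joinxx Order.POrderTheory.le_eqVlt => /orP[/eqP e|//].
have := mleadc_eq0 q; rewrite (negPf q0) e mcoeffB mcoeffZ lead.
by rewrite divfK -?lead ?mleadc_eq0 // lead subrr eqxx.
Qed.

(** The Hilbert basis theorem at the level of zero sets. Dickson's lemma gives finitely many
    elements such that every leading monomial in [P] is divisible by one of theirs; division by them
    is an induction on the leading monomial. *)
Lemma ideal_fin_zeros n (P : {mpoly F[n]} -> Prop) :
    (forall p q, P p -> P q -> P (p - q)) -> (forall p q, P q -> P (p * q)) ->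
  exists s : seq {mpoly F[n]}, (forall p, p \in s -> P p) /\
    forall v, (forall p, p \in s -> p.@[v] = 0) -> forall p, P p -> p.@[v] = 0.
Proof.
move=> PB PM.
have [l [lL Ll]] := dickson (fun m => exists p, [/\ P p, p != 0 & mlead p = m]).
pose pick m := epsilon (inhabits (0 : {mpoly F[n]})) (fun p => [/\ P p, p != 0 & mlead p = m]).
have pickP m : m \in l -> [/\ P (pick m), pick m != 0 & mlead (pick m) = m].
  by move=> /lL ex; apply: epsilon_spec ex.
exists (map pick l); split=> [p /mapP[m /pickP[Pm _ _] ->] //|v v0 p].
elim/mleadrect: p => p IHp Pp; have [->|p0] := eqVneq p 0; first by rewrite meval0.
have [m ml le] : exists2 m, m \in l & (m <= mlead p)%MM by apply: Ll; exists p.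
have [Pm m0 lm] := pickP m ml.
set r := 'X_[mlead p - m] * pick m.
have X0 : 'X_[mlead p - m] != 0 :> {mpoly F[n]}.
  by apply/eqP => /(congr1 (mcoeff (mlead p - m))); rewrite mcoeffX eqxx mcoeff0 => /eqP; rewrite oner_eq0.
have r0 : r != 0 by rewrite mulf_neq0.
have lr : mlead r = mlead p by rewrite mleadM // mleadXm lm submK.
have vr : r.@[v] = 0 by rewrite mevalM (v0 (pick m)) ?mulr0 // map_f.
have /= qE := mlead_cancel p0 r0 lr; set q := p - _ in qE.
have Pq : P q by apply: PB => //; rewrite /r -mul_mpolyC mulrA; apply: PM.
have -> : p.@[v] = q.@[v] by rewrite mevalB mevalZ vr mulr0 subr0.
by case: qE => [->|lt]; [rewrite meval0 | apply: IHp].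
Qed.

End Noether.

Section Closed.
Variables (F : closedFieldType) (I : finType).
Implicit Types (W Z : aset F I) (p q : {mpoly F[#|I|]}).

Lemma pevalB p q x : peval (p - q) x = peval p x - peval q x.
Proof. exact: mevalB. Qed.
Lemma pevalM p q x : peval (p * q) x = peval p x * peval q x.
Proof. exact: mevalM. Qed.

Lemma zclosed_fin W : zclosed W -> exists s : seq {mpoly F[#|I|]},
  forall x, W x <-> (forall p, p \in s -> peval p x = 0).
Proof.
move=> [P WP].
have [||s [sI sV]] := @ideal_fin_zeros F #|I| (fun p => forall x, W x -> peval p x = 0).
- by move=> p q p0 q0 x Wx; rewrite pevalB p0 ?q0 ?subr0.
- by move=> p q q0 x Wx; rewrite pevalM q0 ?mulr0.
exists s => x; split=> [Wx p /sI|/sV sx]; first exact.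
by apply/WP => p Pp; apply: sx => y /WP; apply.
Qed.

(** Without a minimal element there would be an infinite strictly decreasing chain. The union of its
    vanishing ideals has the zeros of a finite subset, which is already present at some stage [N],
    and the chain cannot decrease past that stage. *)
Lemma zclosed_min (Q : aset F I -> Prop) Z : zclosed Z -> Q Z ->
  exists W, [/\ zclosed W, Q W, asubset W Z &
    forall V, zclosed V -> Q V -> asubset V W -> asubset W V].
Proof.
move=> cZ QZ; apply: NNPP => noW.
pose good W := [/\ zclosed W, Q W & asubset W Z].
have step (W : {W | good W}) : exists V : {W | good W},
    asubset (sval V) (sval W) /\ ~ asubset (sval W) (sval V).
  apply: NNPP => noV; apply: noW; exists (sval W); have [cW QW WZ] := svalP W.
  split=> // V cV QV VW; apply: NNPP => nWV; apply: noV.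
  have gV : good V by split=> // x /VW /WZ.
  by exists (exist _ V gV).
pose f T := sval (constructive_indefinite_description _ (step T)).
have fP T : asubset (sval (f T)) (sval T) /\ ~ asubset (sval T) (sval (f T)).
  exact: svalP (constructive_indefinite_description _ (step T)).
have gZ : good Z by split.
pose S i := iter i f (exist _ Z gZ).
have Sdec i j : (i <= j)%N -> asubset (sval (S j)) (sval (S i)).
  move=> /subnK <-; elim: (j - i)%N => [|d IHd] x //=.
  by move=> /(fP (S (d + i)%N)).1 /IHd.
pose P p := exists i, forall x, sval (S i) x -> peval p x = 0.
have [p q [i pi] [j qj]|p q [i qi]|s [sP sV]] := @ideal_fin_zeros F #|I| P.
- exists (maxn i j) => x Sx; rewrite pevalB pi ?qj ?subr0 //.
    by apply: Sdec Sx; rewrite leq_maxr.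
  by apply: Sdec Sx; rewrite leq_maxl.
- by exists i => x Sx; rewrite pevalM qi ?mulr0.
have [N sN] : exists N, forall p, p \in s -> forall x, sval (S N) x -> peval p x = 0.
  elim: (s) sP => [|p s' IHs] s'P; first by exists 0%N.
  have [|N HN] := IHs; first by move=> q qs; apply: s'P; rewrite inE qs orbT.
  have [|i pi] := s'P p; first by rewrite mem_head.
  exists (maxn i N) => q; rewrite inE => /orP[/eqP -> | qs] x Sx.
    by apply: pi; apply: Sdec Sx; rewrite leq_maxl.
  by apply: HN => //; apply: Sdec Sx; rewrite leq_maxr.
case: (fP (S N)) => _; apply => x Sx.
have [[B BP] _ _] := svalP (S N.+1).
apply/BP => p Bp; apply: sV; first by move=> q qs; apply: sN qs x Sx.
by exists N.+1 => y /BP; apply.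
Qed.

End Closed.

(** * Images of dominant maps *)

Section Elimination.
Variable F : closedFieldType.
Implicit Types (t : GRing.term F) (f : GRing.formula F) (e : seq F).

Lemma nth_codom_ord d (v : 'I_d -> F) (i : 'I_d) : (codom v)`_i = v i.
Proof. by rewrite (nth_map i) ?size_enum_ord // nth_ord_enum. Qed.

(** The offset leaves room for the target coordinates, which come first in the environment when an
    image is described by a formula. *)
Lemma term_of_mpoly n off (p : {mpoly F[n]}) : exists t, GRing.rterm t /\
  forall e, GRing.eval e t = p.@[fun i : 'I_n => e`_(off + i)].
Proof.
elim/mpoly_ring_ind: p => [c|i|p q [t [rt te]] [u [ru ue]]|p q [t [rt te]] [u [ru ue]]].
- by exists (GRing.Const c); split=> // e; rewrite mevalC.
- by exists (GRing.Var F (off + i)); split=> // e; rewrite mevalXU.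
- by exists (GRing.Add t u); rewrite /= rt ru; split=> // e; rewrite mevalD te ue.
- by exists (GRing.Mul t u); rewrite /= rt ru; split=> // e; rewrite mevalM te ue.
Qed.

Lemma mpoly_of_term d t : GRing.rterm t ->
  exists p : {mpoly F[d]}, forall v, GRing.eval (codom v) t = p.@[v].
Proof.
elim: t => [i _|c _|n _|t1 IH1 t2 IH2 /andP[/IH1[p1 e1] /IH2[p2 e2]]|t IH /IH[p e]|
            t IH n /IH[p e]|t1 IH1 t2 IH2 /andP[/IH1[p1 e1] /IH2[p2 e2]]|//|t IH n /IH[p e]].
- have [lt|ge] := ltnP i d.
    exists 'X_(Ordinal lt) => v; rewrite mevalXU /=.
    exact: (nth_codom_ord v (Ordinal lt)).
  (* A variable beyond the end of the environment reads the default [0]. *)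
  by exists 0 => v; rewrite meval0 /= nth_default // size_codom card_ord.
- by exists c%:MP => v; rewrite mevalC.
- by exists n%:R => v; rewrite /= -mpolyC_nat mevalC.
- by exists (p1 + p2) => v; rewrite /= mevalD e1 e2.
- by exists (- p) => v; rewrite /= mevalN e.
- by exists (p *+ n) => v; rewrite /= mevalMn e.
- by exists (p1 * p2) => v; rewrite /= mevalM e1 e2.
- by exists (p ^+ n) => v; rewrite /= e rmorphXn.
Qed.

(** An equation either holds identically or fails off the zeros of a nonzero polynomial; connectives
    are handled by multiplying the exceptional polynomials, which stay nonzero in a domain. *)
Lemma constructible_dichotomy d f : GRing.qf_form f -> GRing.rformula f ->
  exists2 g : {mpoly F[d]}, g != 0 &
    (forall v, g.@[v] != 0 -> GRing.holds (codom v) f) \/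
    (forall v, g.@[v] != 0 -> ~ GRing.holds (codom v) f).
Proof.
elim: f => //=.
- move=> b _ _; exists 1; first exact: oner_neq0.
  by case: b; [left|right].
- move=> t1 t2 _ /andP[/(@mpoly_of_term d)[p1 e1] /(@mpoly_of_term d)[p2 e2]].
  have [e|ne] := eqVneq p1 p2.
    by exists 1; [exact: oner_neq0 | left=> v _; rewrite e1 e2 e].
  exists (p1 - p2); first by rewrite subr_eq0.
  by right=> v; rewrite mevalB e1 e2 subr_eq0 => /eqP.
- move=> f1 IH1 f2 IH2 /andP[q1 q2] /andP[r1 r2].
  have [g1 g10 H1] := IH1 q1 r1; have [g2 g20 H2] := IH2 q2 r2.
  case: H1 H2 => [H1 [H2|H2]|H1 _].
  + exists (g1 * g2); first by rewrite mulf_neq0.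
    by left=> v; rewrite mevalM mulf_eq0 negb_or => /andP[/H1 h1 /H2].
  + by exists g2=> //; right=> v /H2 h [_ /h].
  by exists g1=> //; right=> v /H1 h [/h].
- move=> f1 IH1 f2 IH2 /andP[q1 q2] /andP[r1 r2].
  have [g1 g10 H1] := IH1 q1 r1; have [g2 g20 H2] := IH2 q2 r2.
  case: H1 H2 => [H1 _|H1 [H2|H2]].
  + by exists g1=> //; left=> v /H1; left.
  + by exists g2=> //; left=> v /H2; right.
  exists (g1 * g2); first by rewrite mulf_neq0.
  by right=> v; rewrite mevalM mulf_eq0 negb_or => /andP[/H1 h1 /H2 h2] [].
- move=> f1 IH1 f2 IH2 /andP[q1 q2] /andP[r1 r2].
  have [g1 g10 H1] := IH1 q1 r1; have [g2 g20 H2] := IH2 q2 r2.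
  case: H1 H2 => [H1 [H2|H2]|H1 _].
  + by exists g2=> //; left=> v /H2.
  + exists (g1 * g2); first by rewrite mulf_neq0.
    by right=> v; rewrite mevalM mulf_eq0 negb_or => /andP[/H1 h1 /H2 h2] /(_ h1).
  by exists g1=> //; left=> v /H1 n /n.
- move=> f IH q r; have [g g0 H] := IH q r; exists g => //.
  by case: H => H; [right=> v /H h /(_ h) | left].
Qed.

Lemma holds_exists_iota f d n e : size e = d ->
  GRing.holds e (foldr GRing.Exists f (iota d n)) <->
  exists s, size s = n /\ GRing.holds (e ++ s) f.
Proof.
elim: n d e => [|n IHn] d e se /=.
  split=> [h|[s [/size0nil -> h]]]; last by rewrite cats0 in h.
  by exists [::]; rewrite cats0.
have sx x : set_nth 0 e d x = rcons e x by rewrite set_nthE se ltnn subnn cats1.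
split=> [[x]|[[|x s] [//= [sn] h]]].
  rewrite sx => /(IHn d.+1 (rcons e x)) [|s [sn h]]; first by rewrite size_rcons se.
  by exists (x :: s); rewrite -cat_rcons /= sn.
exists x; rewrite sx; apply/(IHn d.+1 (rcons e x)); first by rewrite size_rcons se.
by exists s; rewrite cat_rcons.
Qed.

(* The image is constructible by quantifier elimination, so it or its complement contains a nonempty
   principal open set. *)
Lemma dominant_image n d (s : seq {mpoly F[n]}) (p : 'I_d -> {mpoly F[n]}) :
    (forall q : {mpoly F[d]},
       (forall v, (forall r, r \in s -> r.@[v] = 0) -> q.@[fun i => (p i).@[v]] = 0) ->
     q = 0) ->
  exists2 g : {mpoly F[d]}, g != 0 &
    forall y, g.@[y] != 0 ->
      exists v, (forall r, r \in s -> r.@[v] = 0) /\ forall i, (p i).@[v] = y i.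
Proof.
move=> dom.
(* The environment holds the target point in its first [d] entries and the source point in the next
   [n]; [f0] says that the source satisfies [s], [f1] that it maps to the target. *)
have [f0 [rf0 f0P]] : exists f, GRing.rformula f /\ forall e,
    GRing.holds e f <-> forall r, r \in s -> r.@[fun i : 'I_n => e`_(d + i)] = 0.
  elim: (s) => [|r s' [f [rf fP]]]; first by exists (GRing.Bool true).
  have [t [rt te]] := term_of_mpoly d r.
  exists (GRing.And (GRing.Equal t (GRing.Const 0)) f); rewrite /= rt rf; split=> // e.
  rewrite te fP; split=> [[r0 s0] q|h].
    by rewrite inE => /orP[/eqP ->|/s0].
  by split=> [|q qs]; apply: h; rewrite ?mem_head // inE qs orbT.
have [f1 [rf1 f1P]] : exists f, GRing.rformula f /\ forall e,
    GRing.holds e f <-> forall i, i \in enum 'I_d -> (p i).@[fun i : 'I_n => e`_(d + i)] = e`_i.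
  elim: (enum 'I_d) => [|i l [f [rf fP]]]; first by exists (GRing.Bool true).
  have [t [rt te]] := term_of_mpoly d (p i).
  exists (GRing.And (GRing.Equal t (GRing.Var F i)) f); rewrite /= rt rf; split=> // e.
  rewrite te fP; split=> [[r0 s0] q|h].
    by rewrite inE => /orP[/eqP ->|/s0].
  by split=> [|q qs]; apply: h; rewrite ?mem_head // inE qs orbT.
pose f := foldr GRing.Exists (GRing.And f0 f1) (iota d n).
have rf : GRing.rformula f.
  by rewrite /f; elim: (iota d n) => //=; rewrite rf0 rf1.
have fP y : GRing.holds (codom y) f <->
    exists v, (forall r, r \in s -> r.@[v] = 0) /\ forall i, (p i).@[v] = y i.
  have sy : size (codom y) = d by rewrite size_codom card_ord.
  rewrite holds_exists_iota //; split=> [[u [su /= [/f0P h0 /f1P h1]]]|[v [h0 h1]]].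
    exists (fun i : 'I_n => (codom y ++ u)`_(d + i)); split=> // i.
    by rewrite h1 ?mem_enum // nth_cat sy ltn_ord nth_codom_ord.
  exists (codom v); rewrite size_codom card_ord; split=> //.
  have ev q : q.@[fun i : 'I_n => (codom y ++ codom v)`_(d + i)] = q.@[v].
    apply: meval_eq => i; rewrite nth_cat sy ltnNge leq_addr addKn.
    exact: nth_codom_ord.
  split; [apply/f0P => r rs | apply/f1P => i _]; rewrite ev; first exact: h0.
  by rewrite h1 nth_cat sy ltn_ord nth_codom_ord.
pose qe := @GRing.quantifier_elim F (@ClosedFieldQE.ex_elim F).
have Fclosed := @solve_monicpoly F.
have qeP e : reflect (GRing.holds e f) (GRing.qf_eval e (qe f)).
  apply: GRing.quantifier_elim_rformP => //; first exact: ClosedFieldQE.wf_ex_elim.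
  exact: ClosedFieldQE.holds_ex_elim.
have /andP[qfq rq] : GRing.qf_form (qe f) && GRing.rformula (qe f).
  by apply: GRing.quantifier_elim_wf => //; apply: ClosedFieldQE.wf_ex_elim.
have qP y : GRing.holds (codom y) (qe f) <-> GRing.holds (codom y) f.
  split=> h; first by apply/qeP; apply/(GRing.qf_evalP _ qfq).
  by apply/(GRing.qf_evalP _ qfq); apply/qeP.
have [g g0 [H|H]] := constructible_dichotomy d qfq rq; exists g => // y gy.
  by apply/fP/qP/H.
(* If the open set missed the image, [g] would vanish on the image and dominance would force
   [g = 0]. *)
case/negP: g0; apply/eqP; apply: dom => v v0; apply/eqP/negPn/negP => /H; apply.
by apply/qP/fP; exists v.
Qed.

End Elimination.

(** * Algebraic independence and chains of irreducible closed sets *)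

Section PolyFun.
Variables (F : closedFieldType) (I : finType).

Definition polyfun (u : (I -> F) -> F) : Prop :=
  exists p : {mpoly F[#|I|]}, forall x, u x = peval p x.

Lemma polyfun_peval p : polyfun (@peval F I p).
Proof. by exists p. Qed.

Lemma polyfun_cst c : polyfun (fun _ => c).
Proof. by exists c%:MP => x; rewrite /peval mevalC. Qed.

Lemma polyfun_coord i : polyfun (fun x => x i).
Proof. by exists 'X_(enum_rank i) => x; rewrite /peval mevalXU enum_rankK. Qed.

Lemma polyfunD u w : polyfun u -> polyfun w -> polyfun (fun x => u x + w x).
Proof. by move=> [p pE] [q qE]; exists (p + q) => x; rewrite /peval mevalD pE qE. Qed.

Lemma polyfunM u w : polyfun u -> polyfun w -> polyfun (fun x => u x * w x).
Proof. by move=> [p pE] [q qE]; exists (p * q) => x; rewrite /peval mevalM pE qE. Qed.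

Lemma polyfunB u w : polyfun u -> polyfun w -> polyfun (fun x => u x - w x).
Proof. by move=> [p pE] [q qE]; exists (p - q) => x; rewrite /peval mevalB pE qE. Qed.

Lemma polyfun_sum T (r : seq T) (P : pred T) (u : T -> (I -> F) -> F) :
  (forall t, P t -> polyfun (u t)) -> polyfun (fun x => \sum_(t <- r | P t) u t x).
Proof.
move=> pu; elim: r => [|t r IHr].
  by have [p e] := polyfun_cst 0; exists p => x; rewrite big_nil -e.
case Pt: (P t).
  by have [p e] := polyfunD (pu t Pt) IHr; exists p => x; rewrite big_cons Pt e.
by have [p e] := IHr; exists p => x; rewrite big_cons Pt e.
Qed.

Lemma polyfun_eval d (q : {mpoly F[d]}) (f : 'I_d -> (I -> F) -> F) :
  (forall i, polyfun (f i)) -> polyfun (fun x => q.@[fun i => f i x]).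
Proof.
move=> pf; elim/mpoly_ring_ind: q => [c|i|p q IHp IHq|p q IHp IHq].
- by exists c%:MP => x; rewrite /peval !mevalC.
- by have [p e] := pf i; exists p => x; rewrite mevalXU e.
- by have [r e] := polyfunD IHp IHq; exists r => x; rewrite mevalD e.
- by have [r e] := polyfunM IHp IHq; exists r => x; rewrite mevalM e.
Qed.

End PolyFun.

Lemma polyfun_comp (F : closedFieldType) (I J : finType) u (phi : (I -> F) -> (J -> F)) :
  polyfun u -> (forall j, polyfun (fun x => phi x j)) -> polyfun (fun x => u (phi x)).
Proof.
move=> [p uE] pphi.
have [q qE] := polyfun_eval p (f := fun i x => phi x (enum_val i)) (fun i => pphi _).
by exists q => x; rewrite uE -qE.
Qed.

Section Dimension.
Variables (F : closedFieldType) (I : finType).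
Implicit Types (W Y Z : aset F I).

Definition alg_indep Y d (f : 'I_d -> (I -> F) -> F) : Prop :=
  forall q : {mpoly F[d]}, (forall x, Y x -> q.@[fun i => f i x] = 0) -> q = 0.

(* "The Zariski closure of Y has dimension at least d", for arbitrary Y *)
Definition dim_ge Y d : Prop :=
  exists f : 'I_d -> (I -> F) -> F, (forall i, polyfun (f i)) /\ alg_indep Y f.

Lemma dim_ge_sub Y Z d : asubset Y Z -> dim_ge Y d -> dim_ge Z d.
Proof.
by move=> YZ [f [pf fi]]; exists f; split=> // q q0; apply: fi => x /YZ; apply: q0.
Qed.

Lemma dim_ge0 Y : (exists x, Y x) -> dim_ge Y 0.
Proof.
move=> [x Yx]; exists (fun i _ => 0); split=> [i|q q0]; first exact: polyfun_cst.
by have := q0 x Yx; rewrite [q]nvar0_mpolyC mevalC => ->; rewrite mpolyC0.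
Qed.

Lemma dim_ge_inhab Y d : dim_ge Y d -> exists x, Y x.
Proof.
move=> [f [_ fi]]; apply: NNPP => nY.
have /eqP : 1 = 0 :> {mpoly F[d]} by apply: fi => x Yx; case: nY; exists x.
by rewrite oner_eq0.
Qed.

(** If the functions were dependent on both pieces, the product of the two relations would be a
    nonzero relation on the union. *)
Lemma dim_geU Y Z d : dim_ge (fun x => Y x \/ Z x) d -> dim_ge Y d \/ dim_ge Z d.
Proof.
move=> [f [pf fi]]; apply: NNPP => no.
have dep T : ~ dim_ge T d -> exists2 q : {mpoly F[d]}, q != 0 &
    forall x, T x -> q.@[fun i => f i x] = 0.
  move=> nT; apply: NNPP => noq; apply: nT; exists f; split=> // q q0.
  by apply/eqP/negPn/negP => qn0; apply: noq; exists q.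
have [q q0 qY] := dep Y (fun h => no (or_introl h)).
have [r r0 rZ] := dep Z (fun h => no (or_intror h)).
have /eqP : q * r = 0.
  by apply: fi => x; rewrite mevalM => -[/qY|/rZ] ->; rewrite ?mul0r ?mulr0.
by rewrite mulf_eq0 (negPf q0) (negPf r0).
Qed.

Lemma zclosed_zeros u : polyfun u -> zclosed (fun x : I -> F => u x = 0).
Proof.
move=> [p pE]; exists (fun q => q = p) => x; rewrite pE.
by split=> [p0 q ->|]; last exact.
Qed.

Lemma zclosedI Y Z : zclosed Y -> zclosed Z -> zclosed (fun x => Y x /\ Z x).
Proof.
move=> [P PE] [Q QE]; exists (fun p => P p \/ Q p) => x; rewrite PE QE.
by split=> [[h1 h2] p [/h1|/h2]|h] //; split=> p Pp; apply: h; [left|right].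
Qed.

(** The vanishing ideal of an irreducible closed set is prime. *)
Lemma irreducible_polyfunM W u w : irreducible_closed W -> polyfun u -> polyfun w ->
  (forall x, W x -> u x * w x = 0) ->
  (forall x, W x -> u x = 0) \/ (forall x, W x -> w x = 0).
Proof.
move=> [_ [_ irr]] pu pw uw0.
apply: (irr _ _ (zclosed_zeros pu) (zclosed_zeros pw)) => x /uw0 /eqP.
by rewrite mulf_eq0 => /orP[] /eqP; [left|right].
Qed.

(* Adjoin to f a function g that vanishes on W but not on W': a relation between f and g on W'
   can be divided by g until it restricts to a nontrivial relation between the f on W. *)
Lemma dim_ge_proper W W' d : zclosed W -> irreducible_closed W' -> aproper W W' ->
  dim_ge W d -> dim_ge W' d.+1.
Proof.
move=> [P WP] irrW' [WW' nW'W] [f [pf fi]].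
(* The function to adjoin is an equation of [W] that fails at some point [x0] of [W']. *)
have [p [x0 [pW Wx0 px0]]] : exists p x0, [/\ forall x, W x -> peval p x = 0, W' x0 & peval p x0 <> 0].
  apply: NNPP => no; apply: nW'W => x W'x; apply/WP => p Pp; apply: NNPP => px.
  by apply: no; exists p, x; split=> // y /WP; apply.
pose g := @peval F I p; have pg : polyfun g := polyfun_peval p.
exists (fun i x => snoc (f^~ x) (g x) i); split=> [i|q q0].
  have [[j ->]|->] := widen_or_max i.
    by have [r e] := pf j; exists r => x; rewrite snoc_widen e.
  by exists p => x; rewrite snoc_max.
apply: muni_eq0; apply/eqP/negPn/negP => Q0.
set Q := muni q in Q0.
(* [k] is the order of the relation in the new function; division by [g ^+ k] leaves [u]. *)
have [k Qk kmin] : exists2 k, Q`_k != 0 & forall i, (i < k)%N -> Q`_i = 0.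
  have ex : exists k, Q`_k != 0 by exists (size Q).-1; rewrite -lead_coefE lead_coef_eq0.
  exists (ex_minn ex); case: ex_minnP => // k _ mk i; rewrite ltnNge => h.
  by apply/eqP/negPn/negP => /mk; apply/negP.
pose fx x := fun i : 'I_d => f i x.
pose u x := \sum_(0 <= i < size Q) (Q`_(i + k)).@[fx x] * g x ^+ i.
have pgX i : polyfun (fun x => g x ^+ i).
  elim: i => [|i IHi]; first by exists 1 => x; rewrite /peval meval1.
  by have [r e] := polyfunM pg IHi; exists r => x; rewrite exprS e.
have pu : polyfun u.
  apply: (@polyfun_sum _ _ _ _ predT (fun i x => (Q`_(i + k)).@[fx x] * g x ^+ i)) => i _.
  exact: (polyfunM (polyfun_eval (Q`_(i + k)) pf) (pgX i)).
have qE x : q.@[fun i => snoc (f^~ x) (g x) i] = g x ^+ k * u x.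
  have sQ : (size (map_poly (meval (fx x)) Q) <= size Q + k)%N.
    by apply: leq_trans (size_poly _ _) _; rewrite leq_addr.
  rewrite meval_muni snoc_max.
  rewrite (_ : map_poly _ _ = map_poly (meval (fx x)) Q); last first.
    by apply: eq_map_poly => r; apply: meval_eq => j; rewrite /= snoc_widen.
  rewrite (horner_coef_wide _ sQ) -(big_mkord xpredT (fun i => (map_poly (meval (fx x)) Q)`_i * g x ^+ i)).
  rewrite (@big_cat_nat _ _ _ k) //= ?leq_addl // big1_seq ?add0r; last first.
    by move=> i; rewrite mem_index_iota => /andP[_ ik]; rewrite coef_map /= kmin // meval0 mul0r.
  rewrite -{1}[k]add0n big_addn addnK mulr_sumr; apply: eq_bigr => i _.
  by rewrite coef_map /= exprD mulrA mulrC.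
(* Since [g] is nonzero at [x0], primality makes [u] vanish on [W']. On [W], where [g] is zero, [u]
   reduces to the coefficient of index [k], a nonzero relation between the [f]. *)
have [gk0|u0] : (forall x, W' x -> g x ^+ k = 0) \/ (forall x, W' x -> u x = 0).
- by apply: irreducible_polyfunM => // x W'x; rewrite -qE q0.
- by apply: px0; apply/eqP; have /eqP := gk0 _ Wx0; rewrite expf_eq0 => /andP[].
case/negP: Qk; apply/eqP; apply: fi => x Wx.
have := u0 x (WW' x Wx); rewrite /u.
have Qs : (0 < size Q)%N by rewrite lt0n size_poly_eq0.
rewrite big_ltn // big1_seq => [|i]; first by rewrite expr0 mulr1 addr0.
by rewrite mem_index_iota => /andP[_ /andP[i0 _]]; rewrite /g pW // expr0n eqn0Ngt i0 mulr0.
Qed.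

Lemma chain_dim_ge W d : chain_below W d -> dim_ge W d.
Proof.
move=> [Ws [irr [inc <-]]].
elim: d irr inc => [|d IHd] irr inc.
  by have [_ [ex _]] := irr 0%N isT; apply: dim_ge0.
have [cWd _] := irr d (leqnSn d).
apply: (dim_ge_proper cWd); [exact: irr | exact: inc |].
by apply: IHd => i id; [apply: irr; apply: leqW | apply: inc; apply: leqW].
Qed.

(** A closed subset minimal among those with [dim_ge] at [d] is irreducible: of two closed pieces
    covering it, one still satisfies [dim_ge] at [d] and so is everything. *)
Lemma dim_ge_irreducible Z d : zclosed Z -> dim_ge Z d ->
  exists W, [/\ irreducible_closed W, asubset W Z & dim_ge W d].
Proof.
move=> cZ gZ; have [W [cW gW WZ Wmin]] := zclosed_min (Q := fun Y => dim_ge Y d) cZ gZ.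
exists W; split=> //; split=> //; split; first exact: dim_ge_inhab gW.
move=> A B cA cB WAB.
have [gA|gB] : dim_ge (fun x => W x /\ A x) d \/ dim_ge (fun x => W x /\ B x) d.
- by apply: dim_geU; apply: dim_ge_sub gW => x Wx; case: (WAB x Wx); [left|right].
- by left=> x /(Wmin _ (zclosedI cW cA) gA (fun _ => @proj1 _ _)) [].
- by right=> x /(Wmin _ (zclosedI cW cB) gB (fun _ => @proj1 _ _)) [].
Qed.

(* Cut W by a generic level set of the last of d+1 independent functions. *)
Lemma dim_ge_slice W d : zclosed W -> dim_ge W d.+1 ->
  exists V, [/\ zclosed V, asubset V W, ~ asubset W V & dim_ge V d].
Proof.
move=> cW [f [pf fi]]; have [s Ws] := zclosed_fin cW.
have [p pE] : exists p : 'I_d.+1 -> {mpoly F[#|I|]}, forall i x, f i x = peval (p i) x.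
  exists (fun i => sval (constructive_indefinite_description _ (pf i))) => i.
  exact: svalP (constructive_indefinite_description _ (pf i)).
have [q q0|g g0 gP] := @dominant_image F #|I| d.+1 s p.
  apply: fi => x /Ws sx; rewrite -(q0 (fun i => x (enum_val i)) sx).
  by apply: meval_eq => i; rewrite pE.
have {}gP y : g.@[y] != 0 -> exists2 x, W x & forall i, f i x = y i.
  move=> /gP [v [vs vp]]; exists (fun i => v (enum_rank i)).
    apply/Ws => r /vs <-; apply: meval_eq => i; by rewrite enum_valK.
  by move=> i; rewrite pE -vp; apply: meval_eq => j; rewrite enum_valK.
have [y0 gy0] : exists y, g.@[y] != 0.
  apply: NNPP => no; case/negP: g0; apply/eqP; apply: mpoly_eq0_eval => y.
  by apply/eqP/negPn/negP => gy; apply: no; exists y.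
(* With this level, [g] does not vanish identically on the hyperplane where the last coordinate is
   [a]. *)
pose a := y0 ord_max.
have clast : polyfun (fun x => f ord_max x - a).
  by apply: polyfunB => //; apply: polyfun_cst.
exists (fun x => W x /\ f ord_max x - a = 0); split.
- exact: zclosedI (zclosed_zeros clast).
- by move=> x [].
- move=> sub; have /eqP : 'X_ord_max - a%:MP = 0 :> {mpoly F[d.+1]}.
    by apply: fi => x /sub [_]; rewrite mevalB mevalC mevalXU.
  rewrite subr_eq0 => /eqP /(congr1 (mcoeff U_(ord_max))).
  by rewrite mcoeffXU eqxx mcoeffC mnm1_eq0 mulr0 => /eqP; rewrite oner_eq0.
exists (fun i => f (widen_ord (leqnSn d) i)); split=> // h h0.
have [G GE] : exists G : {mpoly F[d]}, forall y, G.@[y] = g.@[snoc y a].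
  exists (muni g).[a%:MP] => y; rewrite meval_muni snoc_max.
  rewrite -[RHS](_ : (map_poly (meval y) (muni g)).[meval y a%:MP] = _); last first.
    rewrite mevalC; congr (_.[_]); apply: eq_map_poly => r.
    by apply: meval_eq => j; rewrite /= snoc_widen.
  by rewrite horner_map.
(* Where [G] is nonzero, the point is a value of the remaining functions on the slice, so [h]
   vanishes there. *)
have /eqP : h * G = 0.
  apply: mpoly_eq0_eval => y; rewrite mevalM GE.
  have [->|gy] := eqVneq g.@[snoc y a] 0; first by rewrite mulr0.
  have [x Wx fx] := gP _ gy; rewrite (_ : h.@[y] = 0) ?mul0r //.
  rewrite -(h0 x); first by apply: meval_eq => i; rewrite fx snoc_widen.
  by split=> //; rewrite fx snoc_max subrr.
rewrite mulf_eq0 => /orP[/eqP //|/eqP G0].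
suff e : G.@[y0 \o widen_ord (leqnSn d)] = g.@[y0] by rewrite -e G0 meval0 eqxx in gy0.
rewrite GE; apply: meval_eq => i; have [[j ->]|->] := widen_or_max i.
  by rewrite snoc_widen.
by rewrite snoc_max.
Qed.

(** The chain is built from the top: slice, then pass to an irreducible closed subset that keeps the
    [d] functions. *)
Lemma dim_ge_chain W d : irreducible_closed W -> dim_ge W d -> chain_below W d.
Proof.
elim: d W => [|d IHd] W irrW gW; first by exists (fun _ => W).
have [cW _] := irrW; have [V [cV VW nWV gV]] := dim_ge_slice cW gW.
have [U [irrU UV gU]] := dim_ge_irreducible cV gV.
have [Ws [irrs [inc eU]]] := IHd U irrU gU.
exists (fun i => if i == d.+1 then W else Ws i); rewrite eqxx; split; [|split=> //].
  move=> i; rewrite leq_eqVlt; case: eqVneq => //= ne; exact: irrs.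
move=> i; rewrite ltnS leq_eqVlt => /orP[/eqP ->|lt].
  rewrite eqxx ltn_eqF // eU; split=> [x /UV /VW //|WU].
  by apply: nWV => x /WU /UV.
by rewrite !ltn_eqF //; [apply: inc | rewrite ltnS; apply: ltnW].
Qed.

(** An irreducible closed subset carrying [d] independent functions is a component, as a larger one
    would carry [d.+1]; chains in any component are bounded by [d]. *)
Lemma codim_of_dim Z d : zclosed Z -> dim_ge Z d -> (forall e, dim_ge Z e -> (e <= d)%N) ->
  is_codim Z (#|I| - d).
Proof.
move=> cZ gZ dmax; have [W [irrW WZ gW]] := dim_ge_irreducible cZ gZ.
split; last first.
  move=> W' d' [_ [W'Z _]] [ch _]; apply: leq_sub2l; apply: dmax.
  by apply: dim_ge_sub W'Z (chain_dim_ge ch).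
exists W, d; split; [split=> //; split=> // W' irrW' WW' W'Z | split=> //].
  apply: NNPP => nW'W; suff: (d.+1 <= d)%N by rewrite ltnn.
  apply/dmax/(dim_ge_sub W'Z)/(dim_ge_proper _ irrW' _ gW); first by have [] := irrW.
  by split.
split; first exact: dim_ge_chain.
by move=> d' /chain_dim_ge /(dim_ge_sub WZ) /dmax.
Qed.

End Dimension.

(** * Independent coordinates *)

Section Support.
Variables (F : fieldType) (n : nat).
Implicit Types (p q : {mpoly F[n]}) (m : 'X_{1..n}).

Lemma msuppM_ind (Q1 Q2 Q : 'X_{1..n} -> Prop) p q :
    (forall m, m \in msupp p -> Q1 m) -> (forall m, m \in msupp q -> Q2 m) ->
    (forall m1 m2, Q1 m1 -> Q2 m2 -> Q (m1 + m2)%MM) ->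
  forall m, m \in msupp (p * q) -> Q m.
Proof.
move=> h1 h2 h m /msuppM_le /allpairsP [[m1 m2] /= [/h1 ? /h2 ? ->]]; exact: h.
Qed.

Lemma msupp_comp_vars e (j : 'I_e -> 'I_n) (q : {mpoly F[e]}) m i :
  m \in msupp (q \mPo [tuple 'X_(j a) | a < e]) -> i \notin codom j -> m i = 0%N.
Proof.
move=> mq ij; elim/mpoly_ring_ind: q m mq => [c|a|p q IHp IHq|p q IHp IHq] m.
- by rewrite comp_mpolyC msuppC; case: eqP => // _; rewrite inE => /eqP ->; rewrite mnm0E.
- rewrite comp_mpolyXU -tnth_nth tnth_mktuple msuppX inE => /eqP ->; rewrite mnm1E.
  by apply/eqP; rewrite eqb0; apply: contraNneq ij => <-; rewrite codom_f.
- by rewrite comp_mpolyD => /msuppD_le; rewrite mem_cat => /orP[/IHp|/IHq].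
- rewrite rmorphM; move: m; apply: msuppM_ind IHp IHq _ => m1 m2 e1 e2.
  by rewrite mnmDE e1 e2.
Qed.

Lemma mdeg_msuppM p q a b :
    (forall m, m \in msupp p -> (mdeg m <= a)%N) ->
    (forall m, m \in msupp q -> (mdeg m <= b)%N) ->
  forall m, m \in msupp (p * q) -> (mdeg m <= a + b)%N.
Proof.
by move=> h1 h2; apply: msuppM_ind h1 h2 _ => m1 m2 ? ?; rewrite mdegD leq_add.
Qed.

End Support.

Section Counting.
Variables (F : closedFieldType) (n : nat) (Y : ('I_n -> F) -> Prop).

(** Code for a monomial with few large exponents: each exponent is a number below [D] or a pointer
    to one of [e] slots holding numbers below [s]. For fixed [D] and [e] the number of codes grows
    only like [s ^ e]. *)
Definition monomial_of D e s (t : {ffun 'I_n -> 'I_D + 'I_e} * {ffun 'I_e -> 'I_s}) :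
    'X_{1..n} :=
  [multinom match t.1 i with inl a => a : nat | inr b => t.2 b : nat end | i < n].

Lemma monomial_of_large D e s (m : 'X_{1..n}) :
  (#|[set i | D <= m i]| <= e)%N -> (mdeg m < s)%N ->
  exists t, @monomial_of D e s t = m.
Proof.
set A := [set i | _] => Ae ms.
have mi i : (m i < s)%N.
  by apply: leq_ltn_trans ms; rewrite mdegE (bigD1 i) //= leq_addr.
have lt i (iA : i \notin A) : (m i < D)%N by rewrite inE -ltnNge in iA.
case: e Ae => [|e] Ae.
  have A0 i : i \notin A by move: Ae; rewrite leqn0 cards_eq0 => /eqP ->; rewrite inE.
  exists ([ffun i => inl (Ordinal (lt i (A0 i)))], [ffun _ => Ordinal (leq_ltn_trans (leq0n _) ms)]).
  by apply/mnmP => i; rewrite mnmE /= ffunE.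
pose pos i := inord (index i (enum A)) : 'I_e.+1.
pose g i : 'I_D + 'I_e.+1 :=
  match @idP (i \notin A) with
  | ReflectT h => inl (Ordinal (lt i h)) | ReflectF _ => inr (pos i) end.
pose h (b : 'I_e.+1) : 'I_s :=
  if insub (nth 0%N (map m (enum A)) b) is Some a then a
  else Ordinal (leq_ltn_trans (leq0n _) ms).
exists ([ffun i => g i], [ffun b => h b]).
apply/mnmP => i; rewrite mnmE /= ffunE /g; case: {-}_ / idP => [//|/negP].
rewrite negbK => iA; rewrite ffunE /h /pos.
have iE : (index i (enum A) < size (enum A))%N by rewrite index_mem mem_enum.
rewrite inordK; last by apply: leq_trans iE _; rewrite -cardE.
by rewrite (nth_map i) // nth_index ?mem_enum // insubT.
Qed.

(** The sum runs over codes, not monomials, as it is the codes that get counted; several codes may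
    give the same monomial. *)
Definition spanned_on D e s (p : {mpoly F[n]}) : Prop :=
  exists c : {ffun 'I_n -> 'I_D + 'I_e} * {ffun 'I_e -> 'I_s} -> F,
    forall v, Y v -> p.@[v] = \sum_t c t * 'X_[monomial_of t].@[v].

Lemma spanned_on_lin D e s (p : {mpoly F[n]}) :
  (forall m, m \in msupp p -> spanned_on D e s 'X_[m]) -> spanned_on D e s p.
Proof.
move=> red; rewrite [p]mpolyE big_seq.
apply: (big_ind (spanned_on D e s)) => [|q r [c cE] [d dE]|m /red [c cE]].
- by exists (fun _ => 0) => v _; rewrite meval0 big1 // => t _; rewrite mul0r.
- exists (fun t => c t + d t) => v Yv; rewrite mevalD cE // dE // -big_split /=.
  by apply: eq_bigr => t _; rewrite mulrDl.
exists (fun t => p@_m * c t) => v Yv; rewrite mevalZ cE // mulr_sumr.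
by apply: eq_bigr => t _; rewrite mulrA.
Qed.

(** One division step: modulo [p] the leading monomial is a combination of smaller ones, and the
    monomial order is compatible with multiplication by ['X_[m - l]]. *)
Lemma ideal_rewrite (p : {mpoly F[n]}) (m : 'X_{1..n}) :
    p != 0 -> (forall v, Y v -> p.@[v] = 0) -> (mlead p <= m)%MM ->
  exists r : {mpoly F[n]}, (forall m', m' \in msupp r -> (m' < m)%O) /\
    forall v, Y v -> 'X_[m].@[v] = r.@[v].
Proof.
move=> p0 pY lem; set l := mlead p in lem.
pose q := 'X_[l] - (mleadc p)^-1 *: p.
have lc0 : mleadc p != 0 by rewrite mleadc_eq0.
exists ('X_[m - l] * q); split; last first.
  by move=> v Yv; rewrite mevalM mevalB mevalZ pY // mulr0 subr0 -mevalM -mpolyXD submK.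
apply: (msuppM_ind (Q1 := fun m1 => m1 = (m - l)%MM) (Q2 := fun m2 => (m2 < l)%O)).
- by move=> m1; rewrite msuppX inE => /eqP.
- move=> m2 m2q; rewrite Order.POrderTheory.lt_neqAle; apply/andP; split.
    apply: contraTneq m2q => ->; rewrite mcoeff_msupp negbK /q mcoeffB mcoeffX eqxx mcoeffZ.
    by rewrite mulVf // subrr.
  move: m2q => /msuppB_le; rewrite mem_cat => /orP[|/msuppZ_le]; last exact: msupp_le_mlead.
  by rewrite msuppX inE => /eqP ->.
by move=> m1 m2 -> lt; rewrite -[X in (_ < X)%O](submK lem) ltmc_add2r.
Qed.

(* If every e+1 of the coordinates are dependent on Y, then, by division, the monomials with at most e
   large exponents span the polynomial functions on Y. *)
Lemma spanned_on_monomials e :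
    (forall j : 'I_e.+1 -> 'I_n, injective j -> exists2 q : {mpoly F[e.+1]},
       q != 0 & forall v, Y v -> q.@[fun i => v (j i)] = 0) ->
  exists D, forall s (m : 'X_{1..n}), (mdeg m < s)%N -> spanned_on D e s 'X_[m].
Proof.
move=> dep.
have dep' (j : {ffun 'I_e.+1 -> 'I_n}) : exists p : {mpoly F[n]}, injective j ->
    [/\ p != 0, forall v, Y v -> p.@[v] = 0 &
        forall (m : 'X_{1..n}) (i : 'I_n), m \in msupp p -> i \notin codom j -> m i = 0%N].
  have [jinj|nj] := classic (injective j); last by exists 0 => /nj.
  have [q q0 qY] := dep j jinj; exists (q \mPo [tuple 'X_(j a) | a < e.+1]) => _.
  have qE v : (q \mPo [tuple 'X_(j a) | a < e.+1]).@[v] = q.@[fun i => v (j i)].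
    by rewrite comp_mpoly_meval; apply: meval_eq => i; rewrite tnth_mktuple mevalXU.
  split=> [|v Yv|m i]; last exact: msupp_comp_vars.
  - apply: contraNneq q0 => e0; apply/eqP/mpoly_eq0_eval => w.
    (* A point of the coordinates in [j] is extended by zero; injectivity of [j] makes this well
       defined. *)
    pose v i := if [pick a | j a == i] is Some a then w a else 0.
    have := qE v; rewrite e0 meval0 => ->; apply: meval_eq => a.
    by rewrite /v; case: pickP => [b /eqP /jinj ->//|/(_ a)]; rewrite eqxx.
  - by rewrite qE qY.
pose p j := sval (constructive_indefinite_description _ (dep' j)).
have pP (j : {ffun 'I_e.+1 -> 'I_n}) : injective j -> [/\ p j != 0, forall v, Y v -> (p j).@[v] = 0 &
    forall (m : 'X_{1..n}) (i : 'I_n), m \in msupp (p j) -> i \notin codom j -> m i = 0%N].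
  exact: svalP (constructive_indefinite_description _ (dep' j)).
(* The sum over all [j] bounds every exponent of every leading monomial among the chosen
   relations. *)
pose D := (\sum_(j : {ffun 'I_e.+1 -> 'I_n}) mdeg (mlead (p j)))%N.
exists D => s m; elim/(ltmwf (n := n)): m => m IHm ms.
have [small|large] := leqP #|[set i | (D <= m i)%N]| e.
  have [t tm] := monomial_of_large small ms.
  exists (fun t' => (t' == t)%:R) => v _; rewrite (bigD1 t) //= eqxx mul1r tm big1 ?addr0 //.
  by move=> t' /negPf ->; rewrite mul0r.
set A := [set i | _] in large.
(* These [e.+1] coordinates have exponent at least [D] in [m], so the leading monomial of their
   relation divides [m]. *)
pose j := [ffun a => enum_val (widen_ord large a)] : {ffun 'I_e.+1 -> 'I_n}.
have jA a : j a \in A by rewrite ffunE enum_valP.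
have jinj : injective j.
  by move=> a b; rewrite !ffunE => /enum_val_inj /(congr1 val) /= /val_inj.
have [p0 pY psup] := pP j jinj.
have lem : (mlead (p j) <= m)%MM.
  apply/mnm_lepP => i; have [/codomP [a ->]|nij] := boolP (i \in codom j); last first.
    by rewrite (psup _ i (mlead_supp p0)).
  have := jA a; rewrite inE; apply: leq_trans.
  apply: leq_trans (_ : mdeg (mlead (p j)) <= D)%N.
    by rewrite mdegE (bigD1 (j a)) //= leq_addr.
  by rewrite /D (bigD1 j) //= leq_addr.
have [r [rlt rE]] := ideal_rewrite p0 pY lem.
have [|c cE] := @spanned_on_lin D e s r.
  move=> m' /rlt lt; apply: IHm => //; apply: leq_ltn_trans ms.
  by apply: lemc_mdeg; apply: Order.POrderTheory.ltW.
by exists c => v Yv; rewrite rE // cE.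
Qed.

(** Counting argument. If all choices of [e.+1] coordinates were dependent, the [s ^ e.+1] products
    of powers of the [P i] with exponents below [s] would lie in a span indexed by [O(s ^ e)] codes.
    For large [s] this gives a linear relation between the products, that is, a polynomial relation
    between the [P i]. *)
Lemma indep_coordinates_ord e (P : 'I_e -> {mpoly F[n]}) :
    (forall q : {mpoly F[e]}, (forall v, Y v -> q.@[fun i => (P i).@[v]] = 0) -> q = 0) ->
  exists2 j : 'I_e -> 'I_n, injective j &
    forall q : {mpoly F[e]}, (forall v, Y v -> q.@[fun i => v (j i)] = 0) -> q = 0.
Proof.
case: e P => [|e] P Pind.
  exists (fun a : 'I_0 => False_rect _ (notF (ltn_ord a))) => [[]//|q q0].
  by apply: Pind => v Yv; rewrite -(q0 v Yv); apply: meval_eq => -[].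
apply: NNPP => noj.
have [|D red] := @spanned_on_monomials e.
  move=> j jinj; apply: NNPP => noq; apply: noj; exists j => // q q0.
  by apply/eqP/negPn/negP => qn0; apply: noq; exists q.
pose d := (\sum_i msize (P i))%N.
(* Degrees of the products stay below [S], and [S] is at most [(e.+1 * d).+1 * s], so there are at
   most [K * s ^ e] codes; [s] is chosen just above [K]. *)
pose K := ((D + e) ^ n * (e.+1 * d).+1 ^ e)%N.
pose s := K.+1; pose S := (e.+1 * d * s).+1.
pose G (b : {ffun 'I_e.+1 -> 'I_s}) := \prod_i P i ^+ b i.
have Gdeg b m : m \in msupp (G b) -> (mdeg m < S)%N.
  have Pdeg i m' : m' \in msupp (P i) -> (mdeg m' <= d)%N.
    move=> /msize_mdeg_lt /ltnW h; apply: leq_trans h _.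
    by rewrite /d (bigD1 i) //= leq_addr.
  have Xdeg i k m' : m' \in msupp (P i ^+ k) -> (mdeg m' <= k * d)%N.
    elim: k m' => [|k IHk] m'.
      by rewrite expr0 msupp1 inE => /eqP ->; rewrite mdeg0.
    by rewrite exprS mulSn; apply: mdeg_msuppM; [apply: Pdeg | apply: IHk].
  have : forall m, m \in msupp (G b) -> (mdeg m <= \sum_(i < e.+1) s * d)%N.
    rewrite /G; apply: (big_ind2 (fun (p : {mpoly F[n]}) k => forall m, m \in msupp p -> (mdeg m <= k)%N)).
    - by move=> m'; rewrite msupp1 inE => /eqP ->; rewrite mdeg0.
    - by move=> p1 k1 p2 k2; apply: mdeg_msuppM.
    - by move=> i _ m' /Xdeg h; apply: leq_trans h _; rewrite leq_mul2r ltnW ?orbT.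
  move=> /(_ m) h /h; rewrite sum_nat_const card_ord ltnS => /leq_trans; apply.
  by rewrite (mulnC s) mulnA.
have redG b : spanned_on D e S (G b).
  by apply: spanned_on_lin => m /Gdeg; apply: red.
pose c b := sval (constructive_indefinite_description _ (redG b)).
have cE b : forall v, Y v -> (G b).@[v] = \sum_t c b t * 'X_[monomial_of t].@[v].
  exact: svalP (constructive_indefinite_description _ (redG b)).
pose T : finType := ({ffun 'I_n -> 'I_D + 'I_e} * {ffun 'I_e -> 'I_S})%type.
pose B := {ffun 'I_e.+1 -> 'I_s}.
have cardTB : (#|T| < #|B|)%N.
  rewrite /T /B card_prod !card_ffun card_sum !card_ord.
  rewrite [X in (_ < X)%N]expnS; apply: (@leq_ltn_trans (K * s ^ e)); last first.
    by rewrite ltn_mul2r expn_gt0 /s /= ltnS leqnn.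
  rewrite /K -mulnA leq_mul2l -expnMn; apply/orP; right.
  have expn_le a b : (a <= b)%N -> (a ^ e <= b ^ e)%N.
    by move=> ab; elim: (e) => // i IHi; rewrite !expnS leq_mul.
  by apply: expn_le; rewrite /S [X in (_ <= X)%N]mulSn -add1n leq_add2r.
pose M := \matrix_(b < #|B|, t < #|T|) c (enum_val b) (enum_val t).
have [w wM w0] : exists2 w : 'rV_#|B|, w *m M = 0 & w != 0.
  have : kermx M != 0.
    rewrite kermx_eq0 /row_free; apply: contraL cardTB => /eqP rk.
    by rewrite -leqNgt -rk rank_leq_col.
  by move=> /rowV0Pn [w /sub_kermxP wM w0]; exists w.
pose mn (b : B) : 'X_{1..e.+1} := [multinom b i : nat | i < e.+1].
have mn_inj : injective mn.
  move=> b b' /mnmP eb; apply/ffunP => i; apply/val_inj.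
  by have := eb i; rewrite !mnmE.
pose q : {mpoly F[e.+1]} := \sum_b w 0 b *: 'X_[mn (enum_val b)].
have [b wb] : exists b, w 0 b != 0 by move/matrix0Pn: w0 => [i [b]]; rewrite ord1; exists b.
(* The kernel vector [w] is read as a polynomial in the [P i]; its monomials are distinct, so the
   coefficient [w 0 b] survives. *)
have /(congr1 (mcoeff (mn (enum_val b)))) : q = 0.
  apply: Pind => v Yv; rewrite /q raddf_sum /=.
  transitivity (\sum_b w 0 b * (G (enum_val b)).@[v]).
    apply: eq_bigr => i _; rewrite mevalZ mevalX /G rmorph_prod /=; congr (_ * _).
    by apply: eq_bigr => a _; rewrite mnmE rmorphXn.
  transitivity (\sum_t (w *m M) 0 t * ('X_[monomial_of (enum_val t)] : {mpoly F[n]}).@[v]).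
    under [RHS]eq_bigr => t _ do rewrite mxE mulr_suml.
    rewrite exchange_big /=; apply: eq_bigr => i _.
    rewrite cE // mulr_sumr (reindex (fun t : 'I_#|T| => enum_val t)) /=; last first.
      exact/onW_bij/enum_val_bij.
    by apply: eq_bigr => t _; rewrite mxE mulrA.
  by rewrite wM big1 // => t _; rewrite mxE mul0r.
rewrite mcoeff0 /q raddf_sum /= (bigD1 b) //= mcoeffZ mcoeffX eqxx mulr1 big1 ?addr0.
  by move/eqP; rewrite (negPf wb).
move=> b' ne; rewrite mcoeffZ mcoeffX (inj_eq mn_inj) (inj_eq enum_val_inj) (negPf ne).
by rewrite mulr0.
Qed.

End Counting.

Lemma dim_ge_coordinates (F : closedFieldType) (I : finType) (Y : aset F I) d :
  dim_ge Y d -> exists2 j : 'I_d -> I, injective j & alg_indep Y (fun i x => x (j i)).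
Proof.
move=> [f [pf fi]].
pose P i := sval (constructive_indefinite_description _ (pf i)).
have PE i : forall x, f i x = peval (P i) x.
  exact: svalP (constructive_indefinite_description _ (pf i)).
have [|j jinj ji] := @indep_coordinates_ord F #|I| (fun v => Y (fun i => v (enum_rank i))) d P.
  move=> q q0; apply: fi => x Yx; rewrite -(q0 (fun a => x (enum_val a))).
    by apply: meval_eq => i; rewrite PE.
  rewrite (_ : (fun i => _) = x) //; apply: functional_extensionality => i.
  by rewrite enum_rankK.
exists (fun i => enum_val (j i)) => [a b /enum_val_inj /jinj //|q q0].
apply: ji => v Yv; rewrite -(q0 _ Yv).
by apply: meval_eq => i; rewrite enum_valK.
Qed.

(** * Dimension and codimension *)

Section Dim.
Variables (F : closedFieldType) (I : finType).
Implicit Types (W Y Z : aset F I).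

Definition dim_eq Y d : Prop := dim_ge Y d /\ forall e, dim_ge Y e -> (e <= d)%N.

Lemma dim_ge_card Y d : dim_ge Y d -> (d <= #|I|)%N.
Proof. by move=> /dim_ge_coordinates [j /leq_card]; rewrite card_ord. Qed.

Lemma dim_eq_exists Y : (exists x, Y x) -> exists d, dim_eq Y d.
Proof.
move=> /dim_ge0 Y0; have : forall e, dim_ge Y e -> (e <= #|I|)%N by move=> e /dim_ge_card.
elim: #|I| => [|N IHN] bound; first by exists 0%N.
have [YN|nYN] := classic (dim_ge Y N.+1); first by exists N.+1.
apply: IHN => e Ye; have := bound e Ye; rewrite leq_eqVlt => /orP[/eqP eN|//].
by rewrite -eN in nYN.
Qed.

(** The codimension is unique: minimality of [c] is tested on the component supplied by
    [codim_of_dim], and the component realizing [c] has dimension at most [d]. *)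
Lemma dim_of_codim Z c : zclosed Z -> is_codim Z c ->
  exists2 d, dim_eq Z d & c = (#|I| - d)%N.
Proof.
move=> cZ [[W [d1 [[[_ [[x Wx] _]] [WZ _]] [[ch _] cE]]]] cmin].
have [|d [gZ dmax]] := @dim_eq_exists Z; first by exists x; apply: WZ.
exists d => //; have [[W' [d' [W'comp [dimW' e]]]] _] := codim_of_dim cZ gZ dmax.
apply/eqP; rewrite eqn_leq; apply/andP; split; first by rewrite e (cmin W' d').
by rewrite cE leq_sub2l // dmax //; apply: dim_ge_sub WZ (chain_dim_ge ch).
Qed.

Lemma dim_ge_bigU (T : Type) (s : seq T) (Z : T -> aset F I) d :
  dim_ge (fun x => List.Exists (fun t => Z t x) s) d -> exists t, dim_ge (Z t) d.
Proof.
elim: s => [/dim_ge_inhab [x /List.Exists_nil] //|t s IHs] gs.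
have [|gt|/IHs //] := @dim_geU F I (Z t) (fun x => List.Exists (fun t => Z t x) s) d.
  by apply: dim_ge_sub gs => x /List.Exists_cons.
by exists t.
Qed.

Lemma alg_indep_sub Y d e (f : 'I_d -> (I -> F) -> F) (h : 'I_e -> 'I_d) :
  injective h -> alg_indep Y f -> alg_indep Y (fun i => f (h i)).
Proof.
move=> hinj fi q q0.
have qE v : (q \mPo [tuple 'X_(h a) | a < e]).@[v] = q.@[fun i => v (h i)].
  by rewrite comp_mpoly_meval; apply: meval_eq => i; rewrite tnth_mktuple mevalXU.
have e0 : q \mPo [tuple 'X_(h a) | a < e] = 0 by apply: fi => x Yx; rewrite qE q0.
apply/mpoly_eq0_eval => w.
pose v i := if [pick a | h a == i] is Some a then w a else 0.
have := qE v; rewrite e0 meval0 => ->; apply: meval_eq => a.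
by rewrite /v; case: pickP => [b /eqP /hinj ->//|/(_ a)]; rewrite eqxx.
Qed.

End Dim.

(** * Dimension under parametrizations by a product with an affine space *)

Section Product.
Variables (F : closedFieldType) (I J K : finType) (Y : aset F I) (Z : aset F J).

Definition sum_fun (z : J -> F) (w : K -> F) (s : J + K) : F :=
  match s with inl a => z a | inr b => w b end.

(** Pull the [e] functions back to the product and replace them by [e] independent coordinates; at
    most [#|K|] of these belong to the affine factor, the rest are independent on [Z]. *)
Lemma dim_ge_param_upper (phi : (J + K -> F) -> (I -> F)) e :
    (forall i, polyfun (fun x => phi x i)) ->
    (forall y, Y y -> exists z w, Z z /\ phi (sum_fun z w) = y) ->
  dim_ge Y e -> dim_ge Z (e - #|K|).
Proof.
move=> pphi Yphi [f [pf fi]].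
have [] := @dim_ge_coordinates F _ (fun x : J + K -> F => Z (fun a => x (inl a))) e.
  exists (fun i x => f i (phi x)); split=> [i|q q0]; first exact: polyfun_comp.
  apply: fi => y /Yphi [z [w [Zz <-]]]; exact: (q0 (sum_fun z w)).
move=> j jinj ji.
pose A := [set a | if j a is inl _ then true else false].
have cA : (e - #|K| <= #|A|)%N.
  rewrite leq_subLR -{1}(card_ord e) -(cardsC A) addnC leq_add2r.
  rewrite -(card_imset _ jinj) -(card_imset predT (@inr_inj J K)) subset_leq_card //.
  apply/subsetP => s /imsetP [a]; rewrite !inE; case ja: (j a) => [//|b] _ ->.
  exact: imset_f.
pose h (a : 'I_(e - #|K|)) := enum_val (widen_ord cA a).
have hinj : injective h.
  by move=> a b /enum_val_inj /(congr1 val) /= /val_inj.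
have hA a : exists b, j (h a) = inl b.
  by have := enum_valP (widen_ord cA a); rewrite inE -/(h a); case: (j _) => // b _; exists b.
pose b a := sval (constructive_indefinite_description _ (hA a)).
have bE a : j (h a) = inl (b a) by exact: svalP (constructive_indefinite_description _ (hA a)).
exists (fun a z => z (b a)); split=> [a|q q0]; first exact: polyfun_coord.
apply: (alg_indep_sub hinj ji) => x Zx; rewrite -(q0 _ Zx).
by apply: meval_eq => a; rewrite bE.
Qed.

(** The functions on [Z] and the coordinates of the affine factor are pulled back along [psi]. For
    each [w] off the zeros of [g], a relation specialized at [w] is a relation on [Z], hence
    zero. *)
Lemma dim_ge_param_lower (psi : (I -> F) -> (J + K -> F)) (g : {mpoly F[#|K|]}) d :
    (forall s, polyfun (fun x => psi x s)) -> g != 0 ->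
    (forall z w, Z z -> peval g w != 0 -> exists2 y, Y y & psi y = sum_fun z w) ->
  dim_ge Z d -> dim_ge Y (d + #|K|).
Proof.
move=> ppsi g0 psiY [f [pf fi]].
pose tot (z : J -> F) (w : K -> F) (i : 'I_(d + #|K|)) : F :=
  match split i with inl a => f a z | inr b => w (enum_val b) end.
exists (fun i y => tot (fun a => psi y (inl a)) (fun b => psi y (inr b)) i); split=> [i|q q0].
  rewrite /tot; case: (split i) => [a|b]; last exact: ppsi.
  exact: (polyfun_comp (phi := fun y a => psi y (inl a)) (pf a)).
(* [g'] is [g] in the last [#|K|] variables, so that it can multiply [q]. *)
pose g' := g \mPo [tuple 'X_(rshift d b) | b < #|K|].
have g'E v : g'.@[v] = g.@[fun b => v (rshift d b)].
  by rewrite comp_mpoly_meval; apply: meval_eq => b; rewrite tnth_mktuple mevalXU.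
have g'0 : g' != 0.
  apply: contraNneq g0 => e0; apply/eqP/mpoly_eq0_eval => w.
  have := g'E (fun i => if split i is inr b then w b else 0); rewrite e0 meval0 => ->.
  by apply: meval_eq => b; rewrite (unsplitK (inr b)).
suff /eqP : q * g' = 0 by rewrite mulf_eq0 (negPf g'0) orbF => /eqP.
apply: mpoly_eq0_eval => v; rewrite mevalM g'E.
set vK := fun b => v _; have [->|gv] := eqVneq g.@[vK] 0; first by rewrite mulr0.
pose t : 'I_(d + #|K|) -> {mpoly F[d]} :=
  fun i => match split i with inl a => 'X_a | inr b => (vK b)%:MP end.
pose qv := q \mPo [tuple t i | i < d + #|K|].
have qvE u : qv.@[u] = q.@[fun i => match split i with inl a => u a | inr b => vK b end].
  rewrite comp_mpoly_meval; apply: meval_eq => i; rewrite tnth_mktuple /t.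
  by case: (split i) => a; rewrite ?mevalXU ?mevalC.
have qv0 : qv = 0.
  apply: fi => z Zz; have [|y Yy psiE] := psiY z (fun b => vK (enum_rank b)) Zz.
    by rewrite /peval; have -> // : g.@[fun i => vK (enum_rank (enum_val i))] = g.@[vK];
      apply: meval_eq => i; rewrite enum_valK.
  rewrite qvE -(q0 y Yy); apply: meval_eq => i; rewrite /tot psiE /=.
  by case: (split i) => //= b; rewrite enum_valK.
rewrite (_ : q.@[v] = 0) ?mul0r // -(meval0 (fun a => v (lshift #|K| a))) -qv0 qvE.
apply: meval_eq => i; case: splitP => a ia; congr v; exact/val_inj.
Qed.

End Product.

(** * Minors of matrices of truncated power series *)

Section Congruence.
Variable R : comNzRingType.
Implicit Types (p q : {poly R}) (k : nat).

(** Congruence modulo ['X^k], so that computations in the truncated ring take place on plain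
    polynomials. *)
Definition cong k p q : Prop := forall l, (l < k)%N -> p`_l = q`_l.

Lemma cong_sym k p q : cong k p q -> cong k q p.
Proof. by move=> h l /h. Qed.
Lemma cong_trans k p q r : cong k p q -> cong k q r -> cong k p r.
Proof. by move=> h1 h2 l lk; rewrite h1 ?h2. Qed.
Lemma congD k p p' q q' : cong k p p' -> cong k q q' -> cong k (p + q) (p' + q').
Proof. by move=> h1 h2 l lk; rewrite !coefD h1 ?h2. Qed.
Lemma congB k p p' q q' : cong k p p' -> cong k q q' -> cong k (p - q) (p' - q').
Proof. by move=> h1 h2 l lk; rewrite !coefB h1 ?h2. Qed.
Lemma congM k p p' q q' : cong k p p' -> cong k q q' -> cong k (p * q) (p' * q').
Proof.
move=> h1 h2 l lk; rewrite !coefM; apply: eq_bigr => i _.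
by rewrite h1 ?h2 //; apply: leq_ltn_trans lk; rewrite ?leq_subr // -ltnS.
Qed.
Lemma cong0M k p q : cong k q 0 -> cong k (p * q) 0.
Proof. by move=> h; rewrite -(mulr0 p); apply: congM. Qed.

Lemma cong_det k n (A B : 'M[{poly R}]_n) :
  (forall i j, cong k (A i j) (B i j)) -> cong k (\det A) (\det B).
Proof.
move=> AB; rewrite /determinant; apply: (big_ind2 (cong k)) => // [p p' q q'|s _].
  exact: congD.
apply: congM => //; apply: (big_ind2 (cong k)) => // p p' q q'; exact: congM.
Qed.

Lemma congXn k e p : cong (k + e) ('X^e * p) 0 <-> cong k p 0.
Proof.
rewrite mulrC; split=> h l lk.
  have := h (l + e)%N; rewrite ltn_add2r => /(_ lk).
  by rewrite coefMXn ltnNge leq_addl addnK !coef0.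
rewrite coefMXn coef0; case: ltnP => // el; rewrite h ?coef0 //; lia.
Qed.

Definition tpoly k (h : 'I_k -> R) : {poly R} := \sum_(l < k) h l *: 'X^l.

Lemma coef_tpoly k (h : 'I_k -> R) (l : 'I_k) : (tpoly h)`_l = h l.
Proof.
rewrite coef_sum (bigD1 l) //= coefZ coefXn eqxx mulr1 big1 ?addr0 // => i ne.
by rewrite coefZ coefXn [_ == _ :> nat]eq_sym val_eqE (negPf ne) mulr0.
Qed.

Lemma coef_tpoly_ge k (h : 'I_k -> R) l : (k <= l)%N -> (tpoly h)`_l = 0.
Proof.
move=> kl; rewrite coef_sum big1 // => i _; rewrite coefZ coefXn.
by rewrite gtn_eqF ?mulr0 //; apply: leq_trans kl.
Qed.

Lemma cong_tpoly k p : cong k (tpoly (fun l : 'I_k => p`_l)) p.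
Proof. by move=> l lk; rewrite (coef_tpoly _ (Ordinal lk)). Qed.

End Congruence.

Section UnitSeries.
Variable F : fieldType.
Implicit Types (u p : {poly F}).

(** Once the lower coefficients of [p] vanish, coefficient [l] of the product is [u]_0 * p[_l]. *)
Lemma cong_unit_cancel k u p : u`_0 != 0 -> cong k (u * p) 0 -> cong k p 0.
Proof.
move=> u0 up; elim/ltn_ind => l IHl lk.
have := up l lk; rewrite coefM big_ord_recl subn0 big1 ?addr0 => [/eqP|i _].
  by rewrite !coef0 mulf_eq0 (negPf u0) => /eqP.
have lt : (l - lift ord0 i < l)%N by rewrite /= /bump /=; have := ltn_ord i; lia.
by rewrite (IHl _ lt) ?coef0 ?mulr0 //; apply: ltn_trans lk.
Qed.

Lemma cong_inverse k u : u`_0 != 0 -> exists v, cong k (u * v) 1.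
Proof.
move=> u0; elim: k => [|k [v uv]]; first by exists 0.
(* The correction in degree [k] that makes coefficient [k] of the product right. *)
pose c := (1 - u * v)`_k / u`_0.
exists (v + c%:P * 'X^k) => l; rewrite ltnS leq_eqVlt mulrDr mulrCA coefD coefCM coefMXn.
move=> /orP[/eqP ->|lk]; last by rewrite lk mulr0 addr0 uv.
by rewrite ltnn subnn /c divfK // coefB addrC subrK.
Qed.

End UnitSeries.

Section Minors.
Variables (R : comNzRingType) (k : nat).
Implicit Types p : {poly R}.

Lemma cong_sum0 T (s : seq T) (P : pred T) (G : T -> {poly R}) :
  (forall t, P t -> cong k (G t) 0) -> cong k (\sum_(t <- s | P t) G t) 0.
Proof.
move=> h; apply: (big_ind (fun p => cong k p 0)) => // p q hp hq.
by rewrite -(addr0 0); apply: congD.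
Qed.

Lemma cong_det_col n (A : 'M[{poly R}]_n.+1) j :
  (forall i, cong k (\det (row' i (col' j A))) 0) -> cong k (\det A) 0.
Proof.
move=> h; rewrite (expand_det_col A j); apply: cong_sum0 => i _.
by apply: cong0M; apply: cong0M.
Qed.

(* Expanding the bordered matrix [[1, -b], [a, A]], of determinant det (A + a b), along its first row and
   column expresses det (A + a b) through the minors of A of corank one. *)
Lemma cong_det_rank1 n (A : 'M[{poly R}]_n.+1) (a : 'cV_n.+1) (b : 'rV_n.+1) :
  (forall i j, cong k (\det (row' i (col' j A))) 0) -> cong k (\det (A + a *m b)) 0.
Proof.
move=> h; pose B : 'M_(1 + n.+1) := block_mx 1%:M (- b) a A.
have -> : \det (A + a *m b) = \det B.
  have -> : B = block_mx 1%:M 0 a 1%:M *m block_mx 1%:M (- b) 0 (A + a *m b).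
    rewrite mulmx_block !mul1mx !mulmx1 !mul0mx !addr0.
    by rewrite mulmxN addrC addrK.
  by rewrite det_mulmx det_lblock det_ublock !det1 !mul1r.
rewrite (expand_det_row B (0 : 'I_(1 + n.+1))); apply: cong_sum0 => j _.
apply: cong0M; apply: cong0M.
have [j'|] := unliftP (0 : 'I_n.+2) j => [->|->]; last first.
  apply: (@cong_det_col _ _ 0) => i; rewrite (_ : row' 0 (col' 0 B) = A) //.
  by apply/matrixP => x y; rewrite 2!mxE -!rshift1; apply: block_mxEdr.
apply: (@cong_det_col _ _ 0) => i.
rewrite (_ : row' i _ = row' i (col' j' A)) //.
apply/matrixP => x y; do 4!rewrite [LHS]mxE; do 2!rewrite [RHS]mxE.
transitivity (B (rshift 1 (lift i x)) (rshift 1 (lift j' y))); last exact: block_mxEdr.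
by congr (B _ _); apply/val_inj; rewrite /= /bump /=; lia.
Qed.

Definition minors_vanish m n r (A : 'I_m -> 'I_n -> {poly R}) : Prop :=
  forall (f : 'I_r -> 'I_m) (g : 'I_r -> 'I_n), injective f -> injective g ->
    cong k (\det (\matrix_(a < r, b < r) A (f a) (g b))) 0.

Lemma minors_vanish_cong m n r (A B : 'I_m -> 'I_n -> {poly R}) :
  (forall i j, cong k (A i j) (B i j)) -> minors_vanish r A -> minors_vanish r B.
Proof.
move=> AB hA f g fi gi; apply: cong_trans (hA f g fi gi); apply: cong_det => i j.
by rewrite !mxE; apply: cong_sym.
Qed.

Lemma minors_vanish_scale m n r v (A : 'I_m -> 'I_n -> {poly R}) :
  minors_vanish r A -> minors_vanish r (fun i j => v * A i j).
Proof.
move=> hA f g fi gi.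
rewrite (_ : \matrix_(_, _) _ = v *: \matrix_(a, b) A (f a) (g b)); last first.
  by apply/matrixP => i j; rewrite !mxE.
by rewrite detZ; apply: cong0M; apply: hA.
Qed.

Section Pivot.
Variables (m n : nat) (i0 : 'I_m.+1) (j0 : 'I_n.+1).
Implicit Types (u : {poly R}) (a : 'I_m -> {poly R}) (b : 'I_n -> {poly R}).
Implicit Types (C : 'I_m -> 'I_n -> {poly R}).

(* [[u, u b], [a, C + a b]], with the distinguished row and column in position i0 and j0. *)
Definition pivot_mx u a b C (i : 'I_m.+1) (j : 'I_n.+1) : {poly R} :=
  match unlift i0 i, unlift j0 j with
  | None, None => u
  | None, Some y => u * b y
  | Some x, None => a x
  | Some x, Some y => C x y + a x * b y
  end.

(** Adding the distinguished row and column to a minor of [C] gives a matrix that factors into block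
    triangular ones with determinants [u] and that minor. *)
Lemma pivot_minors_in u a b C r :
  minors_vanish r.+1 (pivot_mx u a b C) ->
  forall (f : 'I_r -> 'I_m) (g : 'I_r -> 'I_n), injective f -> injective g ->
    cong k (u * \det (\matrix_(x < r, y < r) C (f x) (g y))) 0.
Proof.
move=> h f g fi gi.
pose ext N (s : 'I_N.+1) (e : 'I_r -> 'I_N) (x : 'I_(1 + r)) : 'I_N.+1 :=
  match split x with inl _ => s | inr y => lift s (e y) end.
have ext_inj N s (e : 'I_r -> 'I_N) : injective e -> injective (ext N s e).
  move=> ei x y; rewrite /ext -{2}(splitK x) -{2}(splitK y).
  case: (split x) (split y) => [x'|x'] [y'|y'].
  - by rewrite (ord1 x') (ord1 y').
  - by move=> e0; have := neq_lift s (e y'); rewrite -e0 eqxx.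
  - by move=> e0; have := neq_lift s (e x'); rewrite e0 eqxx.
  - by move=> /lift_inj /ei ->.
have := h (ext _ i0 f) (ext _ j0 g) (ext_inj _ _ _ fi) (ext_inj _ _ _ gi).
set M := \matrix_(_, _) _; set N := \matrix_(_, _) _.
suff -> : \det M = u * \det N by [].
pose ac : 'cV_r := \col_x a (f x); pose br : 'rV_r := \row_y b (g y).
pose L : 'M_(1 + r) := block_mx u%:M 0 ac 1%:M.
pose U : 'M_(1 + r) := block_mx 1%:M br 0 N.
pose M' : 'M_(1 + r) := M; have e : M' = L *m U.
  rewrite /L /U mulmx_block !mulmx1 !mulmx0 !mul0mx !mul1mx !addr0.
  apply/matrixP => x y; rewrite -(splitK x) -(splitK y).
  case: (split x) (split y) => [x'|x'] [y'|y'] /=;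
    rewrite ?block_mxEul ?block_mxEur ?block_mxEdl ?block_mxEdr !mxE /ext
            ?(unsplitK (inl _)) ?(unsplitK (inr _)) /pivot_mx ?unlift_none ?liftK //.
  - by rewrite (ord1 x') (ord1 y') eqxx mulr1n.
  - by rewrite big_ord1 !mxE (ord1 x') eqxx mulr1n.
  - by rewrite big_ord1 !mxE addrC.
transitivity (\det M') => //; rewrite e.
by rewrite det_mulmx det_lblock det_ublock !det1 det_scalar1 mulr1 mul1r.
Qed.

(** The pivot matrix is [C] bordered by zeros plus a matrix of rank one, so [cong_det_rank1] reduces
    to the minors of size [r] of the bordered matrix: those meeting the border are zero, the others
    are minors of [C]. *)
Lemma pivot_minors_out u a b C r :
  minors_vanish r C -> minors_vanish r.+1 (pivot_mx u a b C).
Proof.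
move=> h f g fi gi.
pose C' i j := if (unlift i0 i, unlift j0 j) is (Some x, Some y) then C x y else 0.
pose a' i := if unlift i0 i is Some x then a x else u.
pose b' j := if unlift j0 j is Some y then b y else 1.
pose A := \matrix_(x < r.+1, y < r.+1) C' (f x) (g y).
rewrite (_ : \matrix_(_, _) _ = A + \col_x a' (f x) *m \row_y b' (g y)); last first.
  apply/matrixP => x y; rewrite !mxE big_ord1 !mxE /pivot_mx /C' /a' /b'.
  by case: (unlift i0 _) (unlift j0 _) => [?|] [?|]; rewrite ?add0r ?mulr1.
apply: cong_det_rank1 => i j.
have [[x fx]|nfx] := classic (exists x, f (lift i x) = i0).
  rewrite (expand_det_row _ x) big1 // => y _.
  by rewrite !mxE /C' fx unlift_none mul0r.
have [[y gy]|ngy] := classic (exists y, g (lift j y) = j0).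
  rewrite (expand_det_col _ y) big1 // => x _.
  by rewrite !mxE /C' gy unlift_none; case: (unlift i0 _) => [?|]; rewrite mul0r.
have fex x : exists x', f (lift i x) = lift i0 x'.
  by case: (unliftP i0 (f (lift i x))) => [x' ->|e]; [exists x' | case: nfx; exists x].
have gex y : exists y', g (lift j y) = lift j0 y'.
  by case: (unliftP j0 (g (lift j y))) => [y' ->|e]; [exists y' | case: ngy; exists y].
pose f' x := sval (constructive_indefinite_description _ (fex x)).
have f'E x : f (lift i x) = lift i0 (f' x).
  exact: svalP (constructive_indefinite_description _ (fex x)).
pose g' y := sval (constructive_indefinite_description _ (gex y)).
have g'E y : g (lift j y) = lift j0 (g' y).
  exact: svalP (constructive_indefinite_description _ (gex y)).
have f'i : injective f'.
  by move=> x x' e; apply: (@lift_inj _ i); apply: fi; rewrite !f'E e.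
have g'i : injective g'.
  by move=> y y' e; apply: (@lift_inj _ j); apply: gi; rewrite !g'E e.
have := h f' g' f'i g'i; congr (cong k (\det _) 0); apply/matrixP => x y.
by rewrite !mxE /C' f'E g'E !liftK.
Qed.

End Pivot.
End Minors.

Lemma minors_vanish_mulXn (R : comNzRingType) k m n r (A : 'I_m -> 'I_n -> {poly R}) :
  minors_vanish (k + r) r (fun i j => 'X * A i j) <-> minors_vanish k r A.
Proof.
have E (f : 'I_r -> 'I_m) (g : 'I_r -> 'I_n) :
    \det (\matrix_(a, b) ('X * A (f a) (g b))) = 'X^r * \det (\matrix_(a, b) A (f a) (g b)).
  by rewrite -detZ; congr (\det _); apply/matrixP => x y; rewrite !mxE.
by split=> h f g fi gi; have := h f g fi gi; rewrite E => /congXn.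
Qed.

(** * Stratification of the determinantal arc varieties *)

Section PolyValued.
Variables (F : closedFieldType) (I : finType).
Implicit Types (U V : (I -> F) -> {poly F}).

Definition polyfun_coefs U : Prop := forall l, polyfun (fun x => (U x)`_l).

Lemma polyfun_ext (u w : (I -> F) -> F) : polyfun u -> u =1 w -> polyfun w.
Proof. by move=> [p pE] e; exists p => x; rewrite -e. Qed.

Lemma polyfun_coefsD U V :
  polyfun_coefs U -> polyfun_coefs V -> polyfun_coefs (fun x => U x + V x).
Proof. by move=> hU hV l; apply: polyfun_ext (polyfunD (hU l) (hV l)) _ => x; rewrite coefD. Qed.

Lemma polyfun_coefsB U V :
  polyfun_coefs U -> polyfun_coefs V -> polyfun_coefs (fun x => U x - V x).
Proof. by move=> hU hV l; apply: polyfun_ext (polyfunB (hU l) (hV l)) _ => x; rewrite coefB. Qed.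

Lemma polyfun_coefsM U V :
  polyfun_coefs U -> polyfun_coefs V -> polyfun_coefs (fun x => U x * V x).
Proof.
move=> hU hV l.
have h := @polyfun_sum F I _ (index_enum 'I_l.+1) predT (fun i x => (U x)`_i * (V x)`_(l - i))
  (fun i _ => polyfunM (hU i) (hV (l - i)%N)).
by apply: polyfun_ext h _ => x; rewrite coefM.
Qed.

Lemma polyfun_coefs_cst p : polyfun_coefs (fun _ => p).
Proof. by move=> l; apply: polyfun_cst. Qed.

Lemma polyfun_coefs_tpoly k (i : 'I_k -> I) : polyfun_coefs (fun x => tpoly (fun l => x (i l))).
Proof.
move=> l; have [lk|kl] := ltnP l k.
  by apply: polyfun_ext (polyfun_coord _ (i (Ordinal lk))) _ => x; rewrite (coef_tpoly _ (Ordinal lk)).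
by apply: polyfun_ext (polyfun_cst _ 0) _ => x; rewrite coef_tpoly_ge.
Qed.

Lemma polyfun_coefs_det n (A : 'I_n -> 'I_n -> (I -> F) -> {poly F}) :
  (forall i j, polyfun_coefs (A i j)) -> polyfun_coefs (fun x => \det (\matrix_(i, j) A i j x)).
Proof.
move=> hA.
have sumP T (s : seq T) (G : T -> (I -> F) -> {poly F}) :
    (forall t, polyfun_coefs (G t)) -> polyfun_coefs (fun x => \sum_(t <- s) G t x).
  move=> hG l; have h := @polyfun_sum F I _ s predT (fun t x => (G t x)`_l) (fun t _ => hG t l).
  by apply: polyfun_ext h _ => x; rewrite coef_sum.
have prodP T (s : seq T) (G : T -> (I -> F) -> {poly F}) :
    (forall t, polyfun_coefs (G t)) -> polyfun_coefs (fun x => \prod_(t <- s) G t x).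
  move=> hG; elim: s => [|t s IHs] l.
    by apply: polyfun_ext (polyfun_coefs_cst 1 l) _ => x; rewrite big_nil.
  by apply: polyfun_ext (polyfun_coefsM (hG t) IHs l) _ => x; rewrite big_cons.
apply: (sumP _ _ (fun (s : {perm 'I_n}) x => (-1) ^+ s * \prod_i (\matrix_(i, j) A i j x) i (s i))) => s.
apply: polyfun_coefsM; first exact: polyfun_coefs_cst.
apply: (prodP _ _ (fun i x => (\matrix_(i, j) A i j x) i (s i))) => i l.
by apply: polyfun_ext (hA i (s i) l) _ => x; rewrite mxE.
Qed.

End PolyValued.

Section Arc.
Variable F : closedFieldType.

Lemma ZvarE m n r k (x : 'I_m * 'I_n * 'I_k -> F) :
  Zvar r x <-> minors_vanish k r (Xt x).
Proof. by split=> h f g fi gi l lk; have := h f g fi gi l lk; rewrite coef0. Qed.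

Lemma coef_Xt m n k (x : 'I_m * 'I_n * 'I_k -> F) i j (l : 'I_k) : (Xt x i j)`_l = x (i, j, l).
Proof. exact: (coef_tpoly (fun l => x (i, j, l))). Qed.

Definition arc_of m n k (A : 'I_m -> 'I_n -> {poly F}) : 'I_m * 'I_n * 'I_k -> F :=
  fun t => (A t.1.1 t.1.2)`_t.2.

Lemma Xt_arc_of m n k (A : 'I_m -> 'I_n -> {poly F}) i j :
  cong k (Xt (arc_of (k := k) A) i j) (A i j).
Proof. exact: (@cong_tpoly F k (A i j)). Qed.

Lemma Zvar_arc_of m n r k (A : 'I_m -> 'I_n -> {poly F}) :
  minors_vanish k r A -> Zvar r (arc_of (k := k) A).
Proof.
by move=> h; apply/ZvarE; apply: minors_vanish_cong h => i j; apply/cong_sym/Xt_arc_of.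
Qed.

Lemma polyfun_coefs_Xt (I : finType) m n k (s : 'I_m * 'I_n * 'I_k -> I) i j :
  polyfun_coefs (fun x : I -> F => Xt (fun t => x (s t)) i j).
Proof. exact: (@polyfun_coefs_tpoly F I k (fun l => s (i, j, l))). Qed.

Lemma zclosed_Zvar m n r k : zclosed (@Zvar F m n r k).
Proof.
exists (fun p => exists (f : 'I_r -> 'I_m) (g : 'I_r -> 'I_n) (l : nat),
  [/\ injective f, injective g, (l < k)%N & forall x, peval p x =
    (\det (\matrix_(a < r, b < r) Xt x (f a) (g b)))`_l]) => x; split.
  by move=> Zx p [f [g [l [fi gi lk ->]]]]; apply: Zx.
move=> h f g fi gi l lk.
have [p pE] : polyfun (fun x : 'I_m * 'I_n * 'I_k -> F =>
    (\det (\matrix_(a < r, b < r) Xt x (f a) (g b)))`_l).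
  by apply: (polyfun_coefs_det (A := fun a b x => Xt x (f a) (g b))) => a b; apply: (polyfun_coefs_Xt id).
by rewrite (pE x); apply: h; exists f, g, l; split=> // y; rewrite -pE.
Qed.

(** * Arcs with a given entry nonzero at the origin *)

Section Pivot.
Variables (m n r k : nat) (i0 : 'I_m.+1) (j0 : 'I_n.+1).

Let J : finType := ('I_m * 'I_n * 'I_k)%type.
Let K : finType := ('I_k + 'I_m * 'I_k + 'I_n * 'I_k)%type.

Let dataU (w : K -> F) : {poly F} := tpoly (fun l => w (inl (inl l))).
Let dataC (w : K -> F) (i : 'I_m) : {poly F} := tpoly (fun l => w (inl (inr (i, l)))).
Let dataR (w : K -> F) (j : 'I_n) : {poly F} := tpoly (fun l => w (inr (j, l))).

Definition pivot_data (u : {poly F}) (a : 'I_m -> {poly F}) (b : 'I_n -> {poly F}) (s : K) : F :=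
  match s with
  | inl (inl l) => u`_l
  | inl (inr (i, l)) => (a i)`_l
  | inr (j, l) => (b j)`_l
  end.

Definition pivot_locus : aset F ('I_m.+1 * 'I_n.+1 * 'I_k)%type :=
  fun x => Zvar r.+1 x /\ (Xt x i0 j0)`_0 != 0.

Lemma card_pivot_data : #|K| = (k * (m + n).+1)%N.
Proof. rewrite !card_sum !card_prod !card_ord; lia. Qed.

(** Such an arc is a pivot matrix modulo ['X^k]. Its pivot is a unit, so cancelling it shows that
    the Schur complement lies in the smaller variety. *)
Lemma dim_pivot_upper e :
  dim_ge pivot_locus e -> dim_ge (@Zvar F m n r k) (e - k * (m + n).+1).
Proof.
rewrite -card_pivot_data.
pose phi (x : J + K -> F) := arc_of (k := k) (pivot_mx i0 j0 (dataU (fun b => x (inr b)))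
  (dataC (fun b => x (inr b))) (dataR (fun b => x (inr b))) (Xt (fun a => x (inl a)))).
apply: (dim_ge_param_upper (phi := phi)) => [[[i j] l]|y [Zy y0]].
  rewrite /phi /arc_of /pivot_mx /=.
  case: (unlift i0 i) (unlift j0 j) => [i'|] [j'|].
  - apply: (polyfun_coefsD _ (polyfun_coefsM _ _)); first exact: polyfun_coefs_Xt.
      exact: polyfun_coefs_tpoly.
    exact: polyfun_coefs_tpoly.
  - exact: polyfun_coefs_tpoly.
  - by apply: polyfun_coefsM; apply: polyfun_coefs_tpoly.
  - exact: polyfun_coefs_tpoly.
have [v uv] := cong_inverse k y0.
pose u := Xt y i0 j0; pose a i := Xt y (lift i0 i) j0.
(* The row is divided by the pivot here, so [phi] only multiplies by [u] and remains polynomial. *)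
pose b j := v * Xt y i0 (lift j0 j).
pose C i j := Xt y (lift i0 i) (lift j0 j) - a i * b j.
have yE i j : cong k (pivot_mx i0 j0 u a b C i j) (Xt y i j).
  rewrite /pivot_mx; case: (unliftP i0 i) => [i' ->|->]; case: (unliftP j0 j) => [j' ->|->] //.
    by rewrite subrK.
  by rewrite /b mulrA -[X in cong k _ X]mul1r; apply: congM.
exists (arc_of C), (pivot_data u a b); split; last first.
  apply: functional_extensionality => -[[i j] l]; rewrite /phi /arc_of /=.
  rewrite -[RHS]coef_Xt -(yE i j l) // /pivot_mx.
  have hU : cong k (dataU (pivot_data u a b)) u by apply: cong_tpoly.
  have hC x : cong k (dataC (pivot_data u a b) x) (a x) by apply: cong_tpoly.
  have hR x : cong k (dataR (pivot_data u a b) x) (b x) by apply: cong_tpoly.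
  case: (unlift i0 i) (unlift j0 j) => [i'|] [j'|].
  - by apply: (congD _ (congM (hC i') (hR j'))) => //; apply: Xt_arc_of.
  - by apply: hC.
  - by apply: (congM hU (hR j')).
  - by apply: hU.
apply: Zvar_arc_of => f g fi gi.
apply: (cong_unit_cancel y0); apply: pivot_minors_in fi gi.
by apply: minors_vanish_cong (proj1 (ZvarE _ _) Zy) => i j; apply: cong_sym.
Qed.

(** To stay polynomial, [psi] returns the Schur complement multiplied by the pivot; the open
    condition [g] is that the pivot be nonzero at the origin. *)
Lemma dim_pivot_lower d : (0 < k)%N ->
  dim_ge (@Zvar F m n r k) d -> dim_ge (@Zvar F m.+1 n.+1 r.+1 k) (d + k * (m + n).+1).
Proof.
move=> k0; rewrite -card_pivot_data.
pose psi (y : 'I_m.+1 * 'I_n.+1 * 'I_k -> F) : J + K -> F := sum_fun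
  (arc_of (fun i j => Xt y i0 j0 * Xt y (lift i0 i) (lift j0 j) -
                      Xt y (lift i0 i) j0 * Xt y i0 (lift j0 j)))
  (pivot_data (Xt y i0 j0) (fun i => Xt y (lift i0 i) j0) (fun j => Xt y i0 (lift j0 j))).
pose l0 := Ordinal k0.
pose g : {mpoly F[#|K|]} := 'X_(enum_rank (inl (inl l0) : K)).
have g0 : g != 0.
  apply/eqP => /(congr1 (fun p => p.@[fun _ => 1])).
  by rewrite mevalXU meval0 => /eqP; rewrite oner_eq0.
have XtP i j : polyfun_coefs (fun y : 'I_m.+1 * 'I_n.+1 * 'I_k -> F => Xt y i j).
  exact: (polyfun_coefs_Xt id).
apply: (dim_ge_param_lower (psi := psi) _ g0) => [[[[i j] l]|[[l|[i l]]|[j l]]]|z w Zz].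
- by apply: polyfun_coefsB; apply: polyfun_coefsM.
- exact: XtP.
- exact: XtP.
- exact: XtP.
rewrite /peval mevalXU enum_rankK => w0.
pose u := dataU w.
have u0 : u`_0 != 0 by rewrite /u /dataU (coef_tpoly _ l0).
have [v uv] := cong_inverse k u0.
(* Dividing [z] and the row by the pivot makes [psi] return exactly [z] and [w]. *)
pose a := dataC w; pose b j := v * dataR w j; pose C i j := v * Xt z i j.
pose A := pivot_mx i0 j0 u a b C.
have uvp p : cong k (u * (v * p)) p.
  by rewrite mulrA -[X in cong k _ X]mul1r; apply: congM.
exists (arc_of A).
  by apply/Zvar_arc_of/pivot_minors_out/minors_vanish_scale/ZvarE.
have AE i j : cong k (Xt (arc_of (k := k) A) i j) (A i j) := Xt_arc_of A i j.
apply: functional_extensionality => -[[[i j] l]|[[l|[i l]]|[j l]]]; rewrite /psi /=.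
- rewrite /arc_of /= -[RHS]coef_Xt.
  rewrite (congB (congM (AE i0 j0) (AE (lift i0 i) (lift j0 j)))
                 (congM (AE (lift i0 i) j0) (AE i0 (lift j0 j)))) //.
  rewrite /A /pivot_mx !unlift_none !liftK.
  rewrite mulrDr [a i * (u * _)]mulrCA addrK; exact: uvp.
- by rewrite AE // /A /pivot_mx !unlift_none /u /dataU coef_tpoly.
- by rewrite AE // /A /pivot_mx unlift_none liftK /a /dataC coef_tpoly.
- rewrite AE // /A /pivot_mx unlift_none liftK (uvp (dataR w j)) //.
  by rewrite /dataR coef_tpoly.
Qed.

End Pivot.

(** * Arcs vanishing at the origin *)

Section Divisible.
Variables (m n r k : nat).

Let K : finType := ('I_m * 'I_n * 'I_r)%type.

(* The arcs of Zvar with X(0) = 0; they are X = t X' with X' mod t^k in the variety for k,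
   and the r remaining coefficients of X' free. *)
Definition divisible_locus : aset F ('I_m * 'I_n * 'I_(k + r.+1))%type :=
  fun x => Zvar r.+1 x /\ forall i j, (Xt x i j)`_0 = 0.

Let glue (z : 'I_m * 'I_n * 'I_k -> F) (w : K -> F) i j : {poly F} :=
  Xt z i j + 'X^k * Xt w i j.

Lemma coef_glue_low z w i j (l : 'I_k) : (glue z w i j)`_l = z (i, j, l).
Proof. by rewrite coefD coef_Xt coefXnM ltn_ord addr0. Qed.

Lemma coef_glue_high z w i j (l : 'I_r) : (glue z w i j)`_(k + l) = w (i, j, l).
Proof.
rewrite coefD coefXnM ltnNge leq_addr /= addKn coef_Xt (_ : (Xt z i j)`_(k + l) = 0) ?add0r //.
exact: (coef_tpoly_ge (fun l => z (i, j, l)) (leq_addr _ _)).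
Qed.

Lemma card_divisible : #|K| = (m * n * r)%N.
Proof. by rewrite !card_prod !card_ord. Qed.

Lemma dim_divisible_upper e :
  dim_ge divisible_locus e -> dim_ge (@Zvar F m n r.+1 k) (e - m * n * r).
Proof.
rewrite -card_divisible.
pose phi (x : _ + K -> F) := arc_of (k := k + r.+1)
  (fun i j => 'X * glue (fun a => x (inl a)) (fun b => x (inr b)) i j).
apply: (dim_ge_param_upper (phi := phi)) => [[[i j] l]|y [Zy y0]].
  apply: (polyfun_coefsM (polyfun_coefs_cst _ 'X)).
  apply: polyfun_coefsD; first exact: (polyfun_coefs_Xt inl).
  apply: (polyfun_coefsM (polyfun_coefs_cst _ 'X^k)); exact: (polyfun_coefs_Xt inr).
pose B i j := drop_poly 1 (Xt y i j).
have yB i j : Xt y i j = 'X * B i j.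
  apply/polyP => -[|l]; rewrite coefXM //= coef_drop_poly addn1 //.
(* Of the [k + r] remaining coefficients, the lowest [k] form [z] and the last [r] form [w]. *)
pose z := arc_of (k := k) B.
pose w : K -> F := fun t => (B t.1.1 t.1.2)`_(k + t.2).
exists z, w; split.
  apply/Zvar_arc_of/minors_vanish_mulXn.
  by apply: minors_vanish_cong (proj1 (ZvarE _ _) Zy) => i j; rewrite yB.
apply: functional_extensionality => -[[i j] l]; rewrite /phi /arc_of /=.
rewrite -[RHS]coef_Xt yB !coefXM; case: l => -[|l] lk //=.
have [lt|ge] := ltnP l k; first exact: (coef_glue_low z w i j (Ordinal lt)).
have lr : (l - k < r)%N by lia.
by rewrite -(subnKC ge) (coef_glue_high z w i j (Ordinal lr)).
Qed.

Lemma dim_divisible_lower d :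
  dim_ge (@Zvar F m n r.+1 k) d -> dim_ge (@Zvar F m n r.+1 (k + r.+1)) (d + m * n * r).
Proof.
rewrite -card_divisible.
pose psi (y : 'I_m * 'I_n * 'I_(k + r.+1) -> F) : _ + K -> F := sum_fun
  (fun t : 'I_m * 'I_n * 'I_k => (Xt y t.1.1 t.1.2)`_(t.2.+1))
  (fun t : K => (Xt y t.1.1 t.1.2)`_((k + t.2).+1)).
(* The open condition is the constant [1]: all values of the free coefficients occur. *)
apply: (dim_ge_param_lower (psi := psi) _ (oner_neq0 _)) => [[[[i j] l]|[[i j] l]]|z w Zz _].
- exact: (polyfun_coefs_Xt id).
- exact: (polyfun_coefs_Xt id).
exists (arc_of (fun i j => 'X * glue z w i j)).
  apply/Zvar_arc_of/minors_vanish_mulXn.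
  apply: minors_vanish_cong (proj1 (ZvarE _ _) Zz) => i j l lk.
  by rewrite (coef_glue_low z w i j (Ordinal lk)) (coef_Xt z i j (Ordinal lk)).
apply: functional_extensionality => -[[[i j] l]|[[i j] l]]; rewrite /psi /=.
- rewrite Xt_arc_of; last by have := ltn_ord l; lia.
  by rewrite coefXM /= coef_glue_low.
- rewrite Xt_arc_of; last by have := ltn_ord l; lia.
  by rewrite coefXM /= coef_glue_high.
Qed.

End Divisible.

(** * Recursion on the truncation order and the minimum formula *)

(** The variety is the union of the divisible locus and the pivot loci over all positions; the bound
    for a pivot locus is the same at each position. *)
Lemma dim_Zvar_recursion m n r k d1 d2 :
    dim_eq (@Zvar F m n r (k + r.+1)) d1 -> dim_eq (@Zvar F m.+1 n.+1 r.+1 k) d2 ->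
  dim_eq (@Zvar F m.+1 n.+1 r.+1 (k + r.+1))
    (maxn (d1 + (k + r.+1) * (m + n).+1) (d2 + m.+1 * n.+1 * r)).
Proof.
move=> [g1 max1] [g2 max2]; split.
  rewrite /maxn; case: ifP => _; first exact: dim_divisible_lower.
  by apply: (dim_pivot_lower ord0 ord0) => //; rewrite addnS.
move=> e ge.
have [] := @dim_geU F _ (@divisible_locus m.+1 n.+1 r k)
  (fun x => List.Exists (fun t => pivot_locus r t.1 t.2 x) (enum {: 'I_m.+1 * 'I_n.+1})) e.
- apply: dim_ge_sub ge => x Zx.
  have [[t xt]|nx] := classic (exists t : 'I_m.+1 * 'I_n.+1, (Xt x t.1 t.2)`_0 != 0).
    right; apply/List.Exists_exists; exists t; split; last by split.
    have : t \in enum {: 'I_m.+1 * 'I_n.+1} by rewrite mem_enum.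
    elim: (enum _) => //= t' s IHs; rewrite inE => /orP[/eqP ->|/IHs]; by [left|right].
  left; split=> // i j; apply/eqP/negPn/negP => xij; apply: nx; by exists (i, j).
- by move=> /dim_divisible_upper /max2 h; rewrite leq_max; apply/orP; right; rewrite leq_subLR addnC in h.
- move=> /dim_ge_bigU [t /dim_pivot_upper /max1 h].
  by rewrite leq_max; apply/orP; left; rewrite leq_subLR addnC in h.
Qed.

Lemma codim_Zvar_recursion m n r k c1 c2 :
    is_codim (@Zvar F m n r (k + r.+1)) c1 -> is_codim (@Zvar F m.+1 n.+1 r.+1 k) c2 ->
  is_codim (@Zvar F m.+1 n.+1 r.+1 (k + r.+1)) (minn c1 (c2 + m.+1 * n.+1)).
Proof.
move=> /(dim_of_codim (@zclosed_Zvar _ _ _ _)) [d1 dim1 ->].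
move=> /(dim_of_codim (@zclosed_Zvar _ _ _ _)) [d2 dim2 ->].
have [g gmax] := dim_Zvar_recursion dim1 dim2.
have := codim_of_dim (@zclosed_Zvar _ _ _ _) g gmax; congr is_codim.
(* Dimensions are at most those of the ambient spaces, so the truncated subtractions are exact. *)
have := dim_ge_card (proj1 dim1); have := dim_ge_card (proj1 dim2).
rewrite !card_prod !card_ord => h2 h1.
nia.
Qed.

(** The ambient space is a single point; this is the end of the recursion when [r] divides [k]. *)
Lemma codim_Zvar0 m n r : is_codim (@Zvar F m n r 0) 0.
Proof.
have N0 : #|{: 'I_m * 'I_n * 'I_0}| = 0%N by rewrite !card_prod !card_ord muln0.
have := @codim_of_dim F _ (@Zvar F m n r 0) 0 (@zclosed_Zvar _ _ _ _).
rewrite subn0 N0; apply; first by apply: dim_ge0; exists (fun _ => 0) => f g _ _ l.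
by move=> e /dim_ge_card; rewrite N0.
Qed.

(** Induction on [lam] with [c] shifted by one. The minimum enters as a lower bound that is
    attained, which survives the shift. *)
Lemma codim_Zvar_min m n r mu lam (c : nat -> nat) :
    (forall s, (s < lam)%N -> is_codim (@Zvar F m n r (mu + (lam - s) * r.+1)) (c s)) ->
    is_codim (@Zvar F m.+1 n.+1 r.+1 mu) (c lam) ->
  forall M, (forall s, (s <= lam)%N -> (M <= c s + s * (m.+1 * n.+1))%N) ->
    (exists2 s, (s <= lam)%N & M = (c s + s * (m.+1 * n.+1))%N) ->
  is_codim (@Zvar F m.+1 n.+1 r.+1 (mu + lam * r.+1)) M.
Proof.
elim: lam c => [|lam IHlam] c hc hmu M Mle [s sl ME].
  by move: sl ME; rewrite leqn0 => /eqP ->; rewrite !addn0 => ->.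
have h0 := hc 0%N isT; rewrite subn0 mulSn addnCA addnC in h0.
rewrite mulSn addnCA addnC.
(* [a] lists the candidates for the shifted sequence; the recursion adds the missing [N]. *)
pose N := m.+1 * n.+1; pose a s := (c s.+1 + s * N)%N.
have [s0 s0l s0min] : exists2 s0, (s0 <= lam)%N & forall s, (s <= lam)%N -> (a s0 <= a s)%N.
  have [i _ imin] := @arg_minnP 'I_lam.+1 ord0 predT (fun i => a i) isT.
  by exists i => [|s' s'l]; [rewrite -ltnS | apply: (imin (Ordinal (s'l : (s' < lam.+1)%N)))].
have := codim_Zvar_recursion h0 (IHlam (fun s => c s.+1) _ hmu (a s0) s0min _).
rewrite (_ : minn _ _ = M).
  apply.
  - by move=> s' s'l; apply: (hc s'.+1).
  - by exists s0.
have a0 := Mle 0%N isT; have as0 := Mle s0.+1 s0l.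
rewrite /a in s0min *.
have : (minn (c 0) (c s0.+1 + s0 * N + N) <= M)%N.
  rewrite ME; case: s sl {ME} => [|s'] s'l; first by rewrite addn0 geq_minl.
  by apply: leq_trans (geq_minr _ _) _; have := s0min s' s'l; rewrite mulSn -/N; lia.
move: a0 as0; rewrite -/N mulSn; lia.
Qed.

End Arc.

(** The starting value [x] takes part in the minimum, hence the extra alternative. *)
Lemma bigminn_ord N x (a : nat -> nat) :
  (forall s, (s < N)%N -> \big[minn/x]_(i < N) a i <= a s)%N /\
  (\big[minn/x]_(i < N) a i = x \/ exists2 s, (s < N)%N & \big[minn/x]_(i < N) a i = a s).
Proof.
elim: N a => [|N IHN] a; first by rewrite big_ord0; split=> //; left.
rewrite big_ord_recl; have [le ex] := IHN (fun s => a s.+1).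
split=> [[_|s /le h]|]; [exact: geq_minl | exact: leq_trans (geq_minr _ _) h |].
rewrite /minn; case: ifP => _; first by right; exists 0%N.
by case: ex => [->|[s sN ->]]; [left | right; exists s.+1].
Qed.

Theorem theorem6p5 (F : closedFieldType) (m n r k : nat)
  (c : nat -> nat) :
  (2 <= r)%N -> (r < m)%N -> (m <= n)%N -> (r <= k)%N ->
  let lam := (k %/ r)%N in
  let mu := (k %% r)%N in
  (forall s, (s < lam)%N ->
     is_codim (@Zvar F (m.-1) (n.-1) (r.-1) (k - r * s)) (c s)) ->
  (if mu == 0%N then c lam = 0%N else is_codim (@Zvar F m n r mu) (c lam)) ->
  is_codim (@Zvar F m n r k)
    (\big[minn/c 0%N]_(s < lam.+1) (c s + s * (m * n)))%N.
Proof.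
case: r => [//|r] _; case: m => [//|m] _; case: n => [//|n] _ rk lam mu hc hmu.
have kE : k = (mu + lam * r.+1)%N by rewrite addnC -divn_eq.
have hmu' : is_codim (@Zvar F m.+1 n.+1 r.+1 mu) (c lam).
  by case: (mu) hmu => [/= ->|//]; apply: codim_Zvar0.
have := bigminn_ord lam.+1 (c 0%N) (fun s => c s + s * (m.+1 * n.+1))%N.
set M := \big[_/_]_(_ < _) _ => -[Mle Mex].
have := @codim_Zvar_min F m n r mu lam c _ hmu' M _ _; rewrite -kE; apply.
- move=> s sl; have := hc s sl.
  have -> // : (k - r.+1 * s = mu + (lam - s) * r.+1)%N.
  by rewrite mulnBl addnBA ?leq_mul2r ?(ltnW sl) ?orbT // -kE (mulnC s).
- by move=> s sl; apply: Mle.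
(* The starting value [c 0] is itself the term with [s = 0]. *)
- case: Mex => [->|[s sl ->]]; first by exists 0%N; rewrite ?addn0.
  by exists s.
Qed.
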